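(* Assume that $\rho_{\min}=\rho_{\max}=\rho$ and $\gamma_{\min}=\gamma_{\max}=\gamma$ (self-similar velocity distribution), and that $\alpha:=\ln\gamma/\ln\rho$ satisfies $0<\alpha<2$. Assume also that $\rho_{\min}>\gamma_{\max}^{1/2}$, that $h_n'(0)=0$ for all $n\in\mathbb{N}$, and that $K_2:=\sup_n\|h_n''\|_\infty<\infty$. Then there exists a constant $C_0$ depending only on $\alpha,K_0,K_2$ such that if $$\rho>C_0,$$ then there exist constants $C_1>0$ depending only on $K_0,\rho$, $C_2>0$ depending only on $K_0,K_2,\rho,\alpha$, and $C_3$ depending only on $K_0$ such that, if $y_t$ is the solution of $dy_t=d\omega_t-\nabla\Gamma(y_t)\,dt$, $y_0=0$, and $t\geq C_3$, then $$C_1\,t^{1+\alpha}\leq\mathbb{E}\big[(y_t\cdot e_2)^2\big]\leq C_2\,t^{1+\alpha}.$$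
   Context: Let $\mathbb{N}=\{0,1,2,\dots\}$. Let $(r_n)_{n\ge 0}$ be integers with $r_0=1$, $\rho_{\min}=\inf_{n\ge1}r_n\ge 2$, $\rho_{\max}=\sup_{n\ge1}r_n<\infty$, and $R_n=\prod_{k=0}^n r_k$. Let $(\gamma_n)_{n\ge0}$ be reals with $\gamma_0=1$, $\gamma_{\min}=\inf_{n\ge0}\gamma_{n+1}/\gamma_n>1$, $\gamma_{\max}=\sup_{n\ge0}\gamma_{n+1}/\gamma_n<\infty$. Let $h_n:\mathbb{R}\to\mathbb{R}$ ($n\ge 0$) be smooth functions of period $1$ with $h_n(0)=0$, $\int_0^1\big(h_n(x)-\int_0^1h_n(y)dy\big)^2dx=1$, $K_0=\sup_n(\sup h_n-\inf h_n)<\infty$ and $\sup_n\|h_n'\|_\infty<\infty$. Put $h(x_1)=\sum_{n=0}^\infty\gamma_nh_n(x_1/R_n)$ (under the assumptions of the claim this is a well-defined $C^2$ function, with $|h'(x)|\le K_2(1-\gamma_{\max}/\rho_{\min}^2)^{-1}|x|$), and $\Gamma(x_1,x_2)=\begin{pmatrix}0&h(x_1)\\-h(x_1)&0\end{pmatrix}$. Let $\omega_t$ be a standard Brownian motion in $\mathbb{R}^2$ started at $0$, and let $(e_1,e_2)$ be the canonical basis. In the equation $dy_t=d\omega_t-\nabla\Gamma(y_t)\,dt$, $y_0=0$, $\nabla\Gamma$ denotes the divergence of the matrix $\Gamma$; explicitly $y_t\cdot e_1=\omega_t\cdot e_1$ and $y_t\cdot e_2=\omega_t\cdot e_2+\int_0^t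 h'(\omega_s\cdot e_1)\,ds$. *)

(* Defs.v *)
From HB Require Import structures.
From mathcomp Require Import all_boot all_order all_algebra.
From mathcomp Require Import all_classical all_reals all_analysis.

Set Implicit Arguments.
Unset Strict Implicit.
Unset Printing Implicit Defensive.

Import Order.TTheory GRing.Theory Num.Theory.
Import numFieldNormedType.Exports.

Local Open Scope classical_set_scope.
Local Open Scope ring_scope.

Section Scales.
Variable R : realType.
Implicit Types (r : nat -> int) (gamma : nat -> R) (f : R -> R)
  (h : nat -> R -> R).

(* All infima and suprema are taken in the extended reals, so that they always
   exist and an equation with a real number includes finiteness. *)

Definition rho_min r : \bar R :=
  ereal_inf [set ((r n)%:~R)%:E | n in [set n | (0 < n)%N]].

Definition rho_max r : \bar R :=
  ereal_sup [set ((r n)%:~R)%:E | n in [set n | (0 < n)%N]].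

Definition scale r (n : nat) : R := (\prod_(k < n.+1) r k)%:~R.

Definition gamma_min gamma : \bar R :=
  ereal_inf (range (fun n => (gamma n.+1 / gamma n)%:E)).

Definition gamma_max gamma : \bar R :=
  ereal_sup (range (fun n => (gamma n.+1 / gamma n)%:E)).

Definition sup_norm f : \bar R := ereal_sup (range (fun x => `|f x|%:E)).

Definition oscillation f : \bar R :=
  (ereal_sup (range (EFin \o f)) - ereal_inf (range (EFin \o f)))%E.

Definition max_oscillation h : \bar R :=
  ereal_sup (range (fun n => oscillation (h n))).

Definition max_deriv_norm (k : nat) h : \bar R :=
  ereal_sup (range (fun n => sup_norm (derive1n k (h n)))).

Definition smooth f : Prop := forall (k : nat) (x : R), derivable (derive1n k f) x 1.

Definition unit_mean f : R := \int[lebesgue_measure]_(x in `[0, 1]) f x.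

Definition unit_variance f : R := unit_mean (fun x => (f x - unit_mean f) ^+ 2).

Record multiscale_data r gamma h : Prop := MultiscaleData {
  r_0 : r 0%N = 1 ;
  rho_min_ge2 : (2%:E <= rho_min r)%E ;
  rho_max_fin : (rho_max r < +oo)%E ;
  gamma_0 : gamma 0%N = 1 ;
  gamma_min_gt1 : (1 < gamma_min gamma)%E ;
  gamma_max_fin : (gamma_max gamma < +oo)%E ;
  h_smooth : forall n, smooth (h n) ;
  h_periodic : forall n x, h n (x + 1) = h n x ;
  h_at_0 : forall n, h n 0 = 0 ;
  h_variance : forall n, unit_variance (h n) = 1 ;
  h_oscillation_fin : (max_oscillation h < +oo)%E ;
  h_deriv_fin : (max_deriv_norm 1 h < +oo)%E }.

Definition shear_profile r gamma h (x : R) : R :=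
  limn (series (fun n => gamma n * h n (x / scale r n))).

(* x |-> [[0, f x_1], [- f x_1, 0]]; the coordinates x_1, x_2 have the
   indices 0 and 1 of 'I_2. *)
Definition shear_stream f (x : 'rV[R]_2) : 'M[R]_2 :=
  f (x 0 0) *: (delta_mx 0 1 - delta_mx 1 0).

(* The divergence contracts the column index: (div M)_i = \sum_j d_j M_ij. *)
Definition mx_divergence (M : 'rV[R]_2 -> 'M[R]_2) (x : 'rV[R]_2) : 'rV[R]_2 :=
  \row_i \sum_j 'D_(delta_mx 0 j) (fun z => M z i j) x.

End Scales.

Section Processes.
Variable R : realType.
Variables (d : measure_display) (T : measurableType d) (P : probability T R).

(* The factors B i = setT give the product rule for all subfamilies of I. *)
Definition mutually_independent (I : finType) (X : I -> T -> R) : Prop :=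
  forall B : I -> set R, (forall i, measurable (B i)) ->
    P (\bigcap_(i in [set: I]) (X i @^-1` B i)) =
    (\prod_(i : I) P (X i @^-1` B i))%E.

(* Processes are indexed by R; only their values at times t >= 0 matter. *)
Definition planar_process (X : R -> T -> 'rV[R]_2) : Prop :=
  forall t, 0 <= t -> forall i, measurable_fun [set: T] (fun w => X t w 0 i).

(* Joint independence over pairs (time step, coordinate) states both that the
   increments are independent and that the two coordinates are. *)
Record brownian_motion (X : R -> T -> 'rV[R]_2) : Prop := BrownianMotion {
  bm_process : planar_process X ;
  bm_start : {ae P, forall w, X 0 w = 0} ;
  bm_continuous :
    {ae P, forall w, {within `[0, +oo[, continuous (fun t => X t w)}} ;
  bm_gaussian : forall s t, 0 <= s -> s < t -> forall (i : 'I_2) (B : set R),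
    measurable B ->
    P ((fun w => X t w 0 i - X s w 0 i) @^-1` B) =
    normal_prob 0 (Num.sqrt (t - s)) B ;
  bm_independent : forall (n : nat) (t : nat -> R), 0 <= t 0%N ->
    (forall k, t k <= t k.+1) ->
    mutually_independent (fun (p : 'I_n * 'I_2) w =>
      X (t p.1.+1) w 0 p.2 - X (t p.1) w 0 p.2) }.

(* dY_t = dX_t + b(Y_t) dt, Y_0 = 0, in integral form. *)
Record sde_solution (X : R -> T -> 'rV[R]_2) (b : 'rV[R]_2 -> 'rV[R]_2)
    (Y : R -> T -> 'rV[R]_2) : Prop := SdeSolution {
  sde_process : planar_process Y ;
  sde_start : {ae P, forall w, Y 0 w = 0} ;
  sde_continuous :
    {ae P, forall w, {within `[0, +oo[, continuous (fun t => Y t w)}} ;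
  sde_equation : {ae P, forall w, forall t, 0 <= t ->
    Y t w = X t w +
      \row_i \int[lebesgue_measure]_(s in `[0, t]) b (Y s w) 0 i} }.

End Processes.

(* Main.v *)
Require Import Defs.
From HB Require Import structures.
From mathcomp Require Import all_boot all_order all_algebra.
From mathcomp Require Import all_classical all_reals all_analysis measurable_realfun.
From mathcomp Require Import ring lra.

(* Write B and W for the coordinates of the Brownian motion, so that
   y_t . e_2 = W_t + int_0^t h'(B_s) ds. Cut h' at a scale n into the slow part
   r = sum_(k > n) u_k' and the fast part g' = sum_(k <= n) u_k', where
   u_k = gamma^k h_k(. / rho^k) and g is determined up to a constant. The slow
   part is Lipschitz with a constant of order K2 gamma^(n+1) / rho^(2 (n+1)).
   For the fast part, Ito's formula for a primitive G of 2 g gives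
     int_a^t g'(B_s) ds = G(B_t) - G(B_a) - 2 int_a^t g(B_s) dB_s,
   and g is bounded by a multiple of gamma^n. With rho^(2 n) of order t this is
   the upper bound.

   For the lower bound take a window [a, t] of length M rho^(2 n), with M
   depending on K0 only, and test y_t against the martingale
   Z = int_a^t (h_n(B_s / rho^n) - mean) dB_s. It is orthogonal to W, to
   everything that happened before a and to r(B_a). The variance of Z is of order
   t - a because h_n has variance 1 and the Gaussian density is bounded below on
   [0, sqrt s]. What is left is small: the boundary terms G(B_t) - G(B_a) of the
   periodic primitive at scale n for large M, and for large rho the lower scales,
   by a factor 1 / gamma, and the oscillation of r, by gamma / rho^2.

   No stochastic integral is used: integrals are replaced by sums over a grid
   with N steps, at a cost O(1 / N) in the second moment, and N is arbitrary. *)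

Import Order.TTheory GRing.Theory Num.Theory.
Import numFieldNormedType.Exports.

Local Open Scope classical_set_scope.
Local Open Scope ring_scope.

Set Implicit Arguments.
Unset Strict Implicit.
Unset Printing Implicit Defensive.

(** * Square-integrable random variables *)

(** The test by Z needs no control on the size of what is orthogonal to it. Up to small terms R, y_t
    = O + R - 2 gamma^n Z with O orthogonal to Z, and O may dwarf Z: it contains the past
    displacement and (t - a) r(B_a). Two constraints shape the window. Its start must satisfy a >=
    rho^(2 n), so that B_s is spread over a full period of scale n throughout, and its length must
    stay comparable to t. Both hold for the largest n with (M + 1) rho^(2 n) <= t; then t < (M + 1)
    rho^(2 n + 2), which is how rho enters the constants. The largeness of rho is used twice:
    rho^alpha = gamma must be large against the lower scales, rho^(2 - alpha) against the higher
    ones. Bounds on h_n' may enter only the O(1 / N) errors, since no final constant may depend on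
    them. The condition h_n'(0) = 0 gives r(0) = 0, so that the upper bound sees only the Lipschitz
    constant of r. *)

Lemma sqr_sum_le (R : realFieldType) (n : nat) (x : 'I_n -> R) :
  (\sum_(i < n) x i) ^+ 2 <= n%:R * \sum_(i < n) x i ^+ 2.
Proof.
elim: n x => [|n ih] x; first by rewrite !big_ord0 expr0n mulr0.
rewrite !big_ord_recr /= -natr1.
have := ih (fun i => x (widen_ord (leqnSn n) i)).
set S := \sum_(i < n) _; set Q := \sum_(i < n) _; set y := x ord_max.
have : 0 <= Q by apply: sumr_ge0 => i _; exact: sqr_ge0.
move: S Q y => S Q y Q0 SQ; have [n0|n0] := eqVneq n 0%N.
  have /eqP : S ^+ 2 == 0 by rewrite eq_le sqr_ge0 (le_trans SQ)// n0 mul0r.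
  move/eqP; rewrite sqrf_eq0 => /eqP ->; rewrite n0; nra.
have n1 : 0 < n%:R :> R by rewrite ltr0n lt0n.
(* Multiplied by n, this follows from (S - n y)^2 >= 0 and S^2 <= n Q. *)
suff : 2 * S * y <= Q + n%:R * y ^+ 2 by nra.
rewrite -(ler_pM2l n1); have := sqr_ge0 (S - n%:R * y); nra.
Qed.

Section SquareIntegrable.
Context d (T : measurableType d) (R : realType) (P : probability T R).
Implicit Types X Y Z : T -> R.

(** Measurability of X^2 does not imply that of X, hence the first conjunct. *)
Definition square_integrable X : Prop :=
  measurable_fun setT X /\ P.-integrable setT (EFin \o (fun w => X w ^+ 2)).

Definition second_moment X : R := \int[P]_w (X w ^+ 2).

Lemma square_integrable_dominated X Y : measurable_fun setT X ->
  (forall w, X w ^+ 2 <= Y w ^+ 2) ->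
  square_integrable Y -> square_integrable X.
Proof.
move=> mX XY [mY iY]; split => //; apply: le_integrable iY => //.
  by apply/measurable_EFinP; exact: measurable_funX.
by move=> w _ /=; rewrite lee_fin !ger0_norm ?sqr_ge0.
Qed.

Lemma square_integrableZ (c : R) X : square_integrable X ->
  square_integrable (fun w => c * X w).
Proof.
move=> [mX iX]; split; first exact: measurable_funM.
rewrite [X in integrable _ _ X](_ : _ =
    (fun w => ((c ^+ 2)%:E * ((EFin \o (fun w => (X w ^+ 2)%R)) w))%E)).
  exact: integrableZl.
by apply/funext => w /=; rewrite -EFinM exprMn.
Qed.

Lemma square_integrableD X Y : square_integrable X -> square_integrable Y ->
  square_integrable (fun w => X w + Y w).
Proof.
move=> [mX iX] [mY iY]; split; first exact: measurable_funD.
have := integrableD measurableT (integrableZl measurableT 2 iX)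
  (integrableZl measurableT 2 iY).
apply: le_integrable => //.
  by apply/measurable_EFinP; apply: measurable_funX; exact: measurable_funD.
move=> w _ /=; rewrite lee_fin !ger0_norm; first by have := sqr_ge0 (X w - Y w); nra.
  by rewrite addr_ge0// mulr_ge0 ?sqr_ge0.
exact: sqr_ge0.
Qed.

Lemma square_integrableB X Y : square_integrable X -> square_integrable Y ->
  square_integrable (fun w => X w - Y w).
Proof.
move=> sX sY.
rewrite (_ : (fun w => _) = fun w => X w + (-1) * Y w).
  by apply: square_integrableD => //; exact: square_integrableZ.
by apply/funext => w; rewrite mulN1r.
Qed.

Lemma square_integrable_cst (c : R) : square_integrable (fun=> c).
Proof. by split => //; exact: finite_measure_integrable_cst. Qed.

Lemma square_integrable_bounded (c : R) X : measurable_fun setT X ->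
  (forall w, `|X w| <= c) -> square_integrable X.
Proof.
move=> mX Xc; apply: square_integrable_dominated (square_integrable_cst c) => //.
move=> w; rewrite -[leLHS]real_normK ?num_real// ler_pXn2r ?nnegrE//.
exact: le_trans (Xc w).
Qed.

Lemma square_integrable_boundedM (c : R) X Y : measurable_fun setT X ->
  (forall w, `|X w| <= c) -> square_integrable Y ->
  square_integrable (fun w => X w * Y w).
Proof.
move=> mX Xc sY.
apply: square_integrable_dominated (square_integrableZ c sY).
  by apply: measurable_funM => //; case: sY.
move=> w; rewrite !exprMn ler_wpM2r ?sqr_ge0//.
rewrite -[leLHS]real_normK ?num_real// ler_pXn2r ?nnegrE//.
exact: le_trans (Xc w).
Qed.

Lemma square_integrable_sum (I : Type) (s : seq I) (X : I -> T -> R) :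
  (forall i, square_integrable (X i)) ->
  square_integrable (fun w => \sum_(i <- s) X i w).
Proof.
move=> sX; elim: s => [|i s ih].
  under eq_fun do rewrite big_nil; exact: square_integrable_cst.
by under eq_fun do rewrite big_cons; exact: square_integrableD.
Qed.

Lemma integrable_prod X Y : square_integrable X -> square_integrable Y ->
  P.-integrable setT (EFin \o (fun w => X w * Y w)).
Proof.
move=> [mX iX] [mY iY]; have := integrableD measurableT iX iY.
apply: le_integrable => //.
  by apply/measurable_EFinP; exact: measurable_funM.
move=> w _ /=; rewrite lee_fin [leRHS]ger0_norm ?addr_ge0 ?sqr_ge0// ler_norml.
by have := sqr_ge0 (X w - Y w); have := sqr_ge0 (X w + Y w); move=> *; apply/andP; split; nra.
Qed.

Lemma square_integrable_integrable X : square_integrable X ->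
  P.-integrable setT (EFin \o X).
Proof.
move=> sX; have := integrable_prod sX (square_integrable_cst 1).
by under [fun w => X w * 1]eq_fun do rewrite mulr1.
Qed.

Lemma second_moment_ge0 X : 0 <= second_moment X.
Proof. by apply: Rintegral_ge0 => w _; exact: sqr_ge0. Qed.

Lemma second_momentE X : square_integrable X ->
  (\int[P]_w ((X w ^+ 2)%R%:E) = (second_moment X)%:E)%E.
Proof. by move=> [_ iX]; rewrite fineK//; exact: integrable_fin_num. Qed.

Lemma second_moment_le X Y : square_integrable X -> square_integrable Y ->
  (forall w, X w ^+ 2 <= Y w ^+ 2) -> second_moment X <= second_moment Y.
Proof. by move=> [_ iX] [_ iY] XY; apply: le_Rintegral. Qed.

Lemma second_momentZ (c : R) X : square_integrable X ->
  second_moment (fun w => c * X w) = c ^+ 2 * second_moment X.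
Proof.
move=> [_ iX]; rewrite /second_moment -RintegralZl//.
by under eq_Rintegral do rewrite exprMn.
Qed.

Lemma second_momentD X Y : square_integrable X -> square_integrable Y ->
  second_moment (fun w => X w + Y w) =
  second_moment X + 2 * \int[P]_w (X w * Y w) + second_moment Y.
Proof.
move=> sX sY; have iXY := integrable_prod sX sY.
case: sX sY => [mX iX] [mY iY].
rewrite /second_moment -RintegralZl// -RintegralD//; last first.
  exact: (integrableZl measurableT 2 iXY).
rewrite -RintegralD//; last first.
  exact: (integrableD measurableT iX (integrableZl measurableT 2 iXY)).
by apply: eq_Rintegral => w _; ring.
Qed.

Lemma second_momentD_le X Y : square_integrable X -> square_integrable Y ->
  second_moment (fun w => X w + Y w) <= 2 * (second_moment X + second_moment Y).
Proof.
move=> sX sY.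
have := second_moment_ge0 (fun w => X w + (-1) * Y w).
have iXY := integrable_prod sX sY.
have -> : second_moment (fun w => X w + (-1) * Y w) =
    second_moment X - 2 * \int[P]_w (X w * Y w) + second_moment Y.
  rewrite second_momentD//; last exact: square_integrableZ.
  rewrite second_momentZ// sqrrN expr1n mul1r.
  have -> : \int[P]_w (X w * (-1 * Y w)) = - \int[P]_w (X w * Y w).
    rewrite -[RHS]mulN1r -RintegralZl//; apply: eq_Rintegral => w _; ring.
  by rewrite mulrN.
rewrite second_momentD//; lra.
Qed.

Lemma second_momentB_le X Y : square_integrable X -> square_integrable Y ->
  second_moment (fun w => X w - Y w) <= 2 * (second_moment X + second_moment Y).
Proof.
move=> sX sY; rewrite (_ : (fun w => _) = fun w => X w + (-1) * Y w).
  rewrite (le_trans (second_momentD_le sX (square_integrableZ (-1) sY)))//.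
  by rewrite second_momentZ// sqrrN expr1n mul1r.
by apply/funext => w; rewrite mulN1r.
Qed.

Lemma Rintegral_sum (I : Type) (s : seq I) (X : I -> T -> R) :
  (forall i, P.-integrable setT (EFin \o X i)) ->
  \int[P]_w (\sum_(i <- s) X i w) = \sum_(i <- s) \int[P]_w X i w.
Proof.
move=> iX; elim: s => [|i s ih].
  under eq_Rintegral do rewrite big_nil.
  by rewrite big_nil Rintegral_cst// mul0r.
rewrite big_cons -ih -RintegralD//.
  by apply: eq_Rintegral => w _; rewrite big_cons.
rewrite [X in integrable _ _ X](_ : _ =
    (fun w => (\sum_(j <- s) (EFin \o X j) w)%E)).
  exact: integrable_sum.
by apply/funext => w /=; rewrite sumEFin.
Qed.

(** Cauchy-Schwarz, for sums without orthogonality. The factor n is affordable when the terms have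
    second moments of order dt^3, as Taylor remainders and Riemann-sum errors do. *)
Lemma second_moment_sum (n : nat) (X : 'I_n -> T -> R) :
  (forall i, square_integrable (X i)) ->
  second_moment (fun w => \sum_(i < n) X i w) <=
  n%:R * \sum_(i < n) second_moment (X i).
Proof.
move=> sX; rewrite /second_moment.
have iX i : P.-integrable setT (EFin \o (fun w => X i w ^+ 2)) := (sX i).2.
have iS : P.-integrable setT (EFin \o (fun w => \sum_(i < n) X i w ^+ 2)).
  rewrite [X in integrable _ _ X](_ : _ =
      (fun w => (\sum_(i < n) (EFin \o (fun w => X i w ^+ 2)%R) w)%E)).
    exact: integrable_sum.
  by apply/funext => w /=; rewrite sumEFin.
rewrite -Rintegral_sum// -RintegralZl//; apply: le_Rintegral => //.
- by case: (square_integrable_sum (index_enum (ordinal n)) sX).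
- exact: (integrableZl measurableT n%:R iS).
- by move=> w _; exact: sqr_sum_le.
Qed.

(** Pythagoras, without the factor n. The compensated squares of the increments require it, their
    second moments being only of order dt^2. *)
Lemma second_moment_orthogonal_sum (n : nat) (X : nat -> T -> R) :
  (forall i, square_integrable (X i)) ->
  (forall i j, (i < j)%N -> \int[P]_w (X i w * X j w) = 0) ->
  second_moment (fun w => \sum_(i < n) X i w) =
  \sum_(i < n) second_moment (X i).
Proof.
move=> sX oX; elim: n => [|n ih].
  rewrite big_ord0 /second_moment.
  under eq_Rintegral do rewrite big_ord0 expr0n.
  by rewrite Rintegral_cst// mul0r.
rewrite big_ord_recr /= -ih.
under eq_fun do rewrite big_ord_recr /=.
rewrite second_momentD//; last exact: square_integrable_sum.
suff -> : \int[P]_w ((\sum_(i < n) X i w) * X n w) = 0 by rewrite mulr0 addr0.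
under eq_Rintegral do rewrite mulr_suml.
rewrite Rintegral_sum; last by move=> i; exact: integrable_prod.
by rewrite big1// => i _; exact: oX.
Qed.

(** Fatou's lemma for the squares: a uniform bound passes to the almost sure limit, and with it
    square integrability. Measurability of V is a hypothesis because the probability space need not
    be complete. *)
Lemma fatou_second_moment (U : nat -> T -> R) (V : T -> R) (C : R) :
  (forall n, square_integrable (U n)) -> (forall n, second_moment (U n) <= C) ->
  measurable_fun setT V ->
  {ae P, forall w, U n w @[n --> \oo] --> V w} ->
  square_integrable V /\ second_moment V <= C.
Proof.
move=> sU UC mV UV.
pose F n w := (U n w ^+ 2)%:E.
have mF n : measurable_fun setT (F n).
  by apply/measurable_EFinP; apply: measurable_funX; case: (sU n).
have F0 n w : setT w -> (0 <= F n w)%E by move=> _; rewrite lee_fin sqr_ge0.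
have mV2 : measurable_fun setT (fun w => (V w ^+ 2)%:E).
  by apply/measurable_EFinP; exact: measurable_funX.
have mliminf : measurable_fun setT (fun w => limn_einf (F^~ w)).
  rewrite /limn_einf; apply: measurableT_comp => //.
  apply: measurable_fun_limn_esup => n; exact: measurableT_comp.
have limF w : U n w @[n --> \oo] --> V w -> limn_einf (F^~ w) = (V w ^+ 2)%:E.
  move=> Uw; apply: (cvg_limn_einf_sup _).1.
  apply: cvg_EFin; first exact: nearW.
  by rewrite [X in X @ _]/comp/= expr2; under eq_fun do rewrite expr2; exact: cvgM.
have IV : (\int[P]_w (V w ^+ 2)%:E = \int[P]_w limn_einf (F^~ w))%E.
  apply: ae_eq_integral => //.
  by apply: filterS UV => w Uw _; rewrite limF.
have le : (\int[P]_w (V w ^+ 2)%:E <= C%:E)%E.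
  rewrite IV (le_trans (fatou P measurableT mF F0))//.
  rewrite limn_einf_lim; apply: lime_le; first exact: is_cvg_einfs.
  apply: nearW => n; rewrite /einfs.
  apply: (@le_trans _ _ (\int[P]_w F n w)%E).
    by apply: ereal_inf_lbound; exists n => /=.
  by rewrite /F second_momentE// lee_fin.
have sV : square_integrable V.
  split => //; apply/integrableP; split => //.
  under eq_integral do rewrite /= ger0_norm ?sqr_ge0//.
  by rewrite (le_lt_trans le)// ltry.
by split => //; rewrite -lee_fin -second_momentE.
Qed.

End SquareIntegrable.

(** * Independence *)

Section Independence.
Context d (T : measurableType d) (R : realType) (P : probability T R).

(** The law of (U, V) agrees with the product of the two laws on rectangles, hence everywhere;
    Fubini's theorem then factors the integral. *)
Lemma Rintegral_independent (U V : T -> R) :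
  square_integrable P U -> square_integrable P V ->
  (forall A B, measurable A -> measurable B ->
    P (U @^-1` A `&` V @^-1` B) = (P (U @^-1` A) * P (V @^-1` B))%E) ->
  \int[P]_w (U w * V w) = (\int[P]_w U w) * (\int[P]_w V w).
Proof.
move=> sU sV iUV.
have iP := integrable_prod sU sV.
have iU := square_integrable_integrable sU.
have iV := square_integrable_integrable sV.
case: sU sV => [mU _] [mV _].
pose U' : {mfun T >-> R} :=
  MeasurableFun.Pack (MeasurableFun.Class (isMeasurableFun.Build _ _ _ _ _ mU)).
pose V' : {mfun T >-> R} :=
  MeasurableFun.Pack (MeasurableFun.Class (isMeasurableFun.Build _ _ _ _ _ mV)).
have mW : measurable_fun setT (fun w => (U w, V w)).
  exact: measurable_fun_pair.
pose W : {mfun T >-> (R * R)%type} :=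
  MeasurableFun.Pack (MeasurableFun.Class (isMeasurableFun.Build _ _ _ _ _ mW)).
pose f : R * R -> \bar R := fun z => (z.1 * z.2)%:E.
have mf : measurable_fun setT f.
  by apply/measurable_EFinP; exact: measurable_funM.
have eqm : forall X, measurable X ->
    (distribution P U' \x distribution P V')%E X = distribution P W X.
  apply: product_measure_unique => A B mA mB.
  by rewrite /distribution /pushforward/= -iUV.
have if' : (distribution P W).-integrable setT f.
  by apply: integrable_pushforward.
have ifx : (distribution P U' \x distribution P V')%E.-integrable setT f.
  apply/integrableP; split => //.
  rewrite (eq_measure_integral (distribution P W)).
    by case/integrableP : if'.
  by move=> A mA _; exact: eqm.
have iV' : (distribution P V').-integrable setT (EFin \o id).
  by apply: integrable_pushforward => //; exact/measurable_EFinP.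
have iU' : (distribution P U').-integrable setT (EFin \o id).
  by apply: integrable_pushforward => //; exact/measurable_EFinP.
have EV : (\int[distribution P V']_y y%:E)%E = (\int[P]_w V w)%:E.
  rewrite (@integral_distribution _ _ _ _ _ P V' EFin)//.
  by rewrite fineK//; exact: integrable_fin_num.
have EU : (\int[distribution P U']_y y%:E)%E = (\int[P]_w U w)%:E.
  rewrite (@integral_distribution _ _ _ _ _ P U' EFin)//.
  by rewrite fineK//; exact: integrable_fin_num.
have : (\int[P]_w (U w * V w)%:E = (\int[P]_w U w)%:E * (\int[P]_w V w)%:E)%E.
  rewrite -(@integral_distribution _ _ _ _ _ P W f)//.
  rewrite -(eq_measure_integral _ (fun A mA _ => eqm A mA)).
  rewrite -integral12_prod_meas1//.
  rewrite /fubini_F /f/= -EU -EV.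
  under eq_integral => x _.
    under eq_integral do rewrite EFinM.
    rewrite (integralZl measurableT iV') EV.
    over.
  by rewrite EV (integralZr measurableT iU').
by rewrite /Rintegral => ->.
Qed.

(** * Independence of one variable from the sigma-algebra of all the others *)

Section Family.
Variables (I : finType) (X : I -> T -> R) (p0 : I).
Hypotheses (mX : forall i, measurable_fun setT (X i))
  (indX : mutually_independent P X).

(* The pi-system generating the sigma-algebra of the variables other than p0. *)
Definition cylinders_without : set (set T) :=
  [set D | exists2 B : I -> set R, (forall i, measurable (B i)) /\ B p0 = setT &
    D = \bigcap_(i in setT) (X i @^-1` B i)].

Lemma cylinders_without_setI : setI_closed cylinders_without.
Proof.
move=> _ _ [B [mB B0] ->] [C [mC C0] ->].
exists (fun i => B i `&` C i); first split.
- by move=> i; exact: measurableI.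
- by rewrite B0 C0 setTI.
by rewrite -bigcapI; apply: eq_bigcapr => i _; rewrite preimage_setI.
Qed.

Lemma measurable_cylinder (B : I -> set R) : (forall i, measurable (B i)) ->
  measurable (\bigcap_(i in setT) (X i @^-1` B i)).
Proof.
move=> mB; apply: fin_bigcap_measurable => // i _.
by rewrite -[X in measurable X]setTI; exact: mX.
Qed.

(** Dynkin's argument: for fixed B the events D that satisfy the product rule form a lambda-system,
    and it contains the pi-system of cylinders by mutual independence. *)
Lemma sigma_cylinders_independent (D : set T) (B : set R) :
  <<s cylinders_without >> D -> measurable B ->
  measurable D /\ P (D `&` X p0 @^-1` B) = (P D * P (X p0 @^-1` B))%E.
Proof.
move=> sD mB.
pose H := [set D | measurable D /\
  P (D `&` X p0 @^-1` B) = (P D * P (X p0 @^-1` B))%E].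
have mV : measurable (X p0 @^-1` B).
  by rewrite -[X in measurable X]setTI; exact: mX.
suff : <<s cylinders_without >> `<=` H by apply.
apply: lambda_system_subset => //.
- exact: cylinders_without_setI.
- apply/dynkin_lambda_system; split.
  + by split => //; rewrite setTI probability_setT mul1e.
  + move=> E [mE iE]; split; first exact: measurableC.
    rewrite setIC -setDE measureD// ?(le_lt_trans (probability_le1 _ _) (ltry _))//.
    rewrite probability_setC// muleBl ?fin_num_measure// ?mul1e.
    by rewrite -iE (setIC E).
  + move=> F tF HF; split.
      by apply: bigcup_measurable => k _; case: (HF k).
    rewrite setI_bigcupl measure_bigcup//=; last 2 first.
      by move=> k _; apply: measurableI => //; case: (HF k).
      apply: trivIset_setIr => //.
    rewrite measure_bigcup//; last by move=> k _; case: (HF k).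
    have PV : P (X p0 @^-1` B) = (fine (P (X p0 @^-1` B)))%:E.
      by rewrite fineK// fin_num_measure.
    rewrite muleC PV -nneseriesZl//.
    by apply: eq_eseriesr => k _; rewrite muleC -PV; case: (HF k).
- move=> _ [C [mC C0] ->]; split; first exact: measurable_cylinder.
  (* [C] puts no constraint on [p0], so inserting B there turns the intersection into a cylinder of
     the whole family, to which [indX] applies. *)
  pose C' i := if i == p0 then B else C i.
  have mC' i : measurable (C' i) by rewrite /C'; case: ifP.
  have -> : \bigcap_(i in setT) (X i @^-1` C i) `&` X p0 @^-1` B =
            \bigcap_(i in setT) (X i @^-1` C' i).
    apply/seteqP; split => [w [Cw Bw] i _|w Cw].
      by rewrite /C' /preimage/=; case: eqP => [->//|_]; exact: Cw.
    split=> [i _|]; last by have := Cw p0 Logic.I; rewrite /C' /preimage/= eqxx.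
    have := Cw i Logic.I; rewrite /C' /preimage/=; case: eqP => [-> _|//].
    by rewrite C0.
  rewrite !indX// (bigD1 p0)//= [in RHS](bigD1 p0)//= C0 preimage_setT.
  rewrite probability_setT mul1e muleC /C' eqxx; congr (_ * _)%E.
  by apply: eq_bigr => i /negbTE ->.
Qed.

(** A functional U of arbitrarily many of the other variables is treated at once: only its
    measurability for the generated sigma-algebra has to be checked. *)
Lemma Rintegral_independent_family (U : T -> R) (psi : R -> R) :
  measurable_fun (setT : set (g_sigma_algebraType cylinders_without)) U ->
  measurable_fun setT psi ->
  square_integrable P U -> square_integrable P (psi \o X p0) ->
  \int[P]_w (U w * psi (X p0 w)) =
  (\int[P]_w U w) * (\int[P]_w psi (X p0 w)).
Proof.
move=> mU mpsi sU sV.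
apply: (Rintegral_independent sU sV) => A B mA mB.
rewrite comp_preimage.
have mB' : measurable (psi @^-1` B).
  by rewrite -[X in measurable X]setTI; exact: mpsi.
have := sigma_cylinders_independent _ mB'.
move=> /(_ (U @^-1` A)) []//.
by have := mU measurableT A mA; rewrite setTI.
Qed.

Lemma measurable_family (q : I) : q != p0 ->
  measurable_fun (setT : set (g_sigma_algebraType cylinders_without)) (X q).
Proof.
move=> qp0 _ B mB; rewrite setTI; apply: sub_sigma_algebra.
exists (fun i => if i == q then B else setT).
  by split => [i|]; [case: ifP|rewrite eq_sym (negbTE qp0)].
apply/seteqP; split => [w Bw i _|w Bw].
  by rewrite /preimage/=; case: eqP => [->|].
by have := Bw q Logic.I; rewrite /preimage/= eqxx.
Qed.

End Family.
End Independence.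

(** * Riemann sums and Taylor expansions *)

Section RealAnalysis.
Context (R : realType).
Implicit Types (f c A : R -> R).
Notation mu := (@lebesgue_measure R).

Lemma is_derive_continuous A (x v : R) : is_derive x 1 A v ->
  {for x, continuous A}.
Proof. by move=> dA; apply: differentiable_continuous; apply/derivable1_diffP. Qed.

(** The position of z is recorded as a distance so that x and y may come in either order. *)
Lemma mean_value A c (x y : R) : (forall z : R, is_derive z 1 A (c z)) ->
  exists2 z, `|z - x| <= `|y - x| & A y - A x = c z * (y - x).
Proof.
move=> dA; have cA s : {within s, continuous A}.
  by apply: continuous_subspaceT => z; exact: is_derive_continuous.
have [xy|yx] := leP x y.
  have [z] := MVT_segment xy (fun z _ => dA z) (cA _).
  rewrite in_itv/= => /andP[xz zy] E; exists z => //.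
  by rewrite !ger0_norm ?subr_ge0// lerB.
have [z] := MVT_segment (ltW yx) (fun z _ => dA z) (cA _).
rewrite in_itv/= => /andP[yz zx] E; exists z.
  by rewrite ler0_norm ?subr_le0// (@ler0_norm _ (y - x)) ?subr_le0 1?(ltW yx)//; lra.
by rewrite -opprB E -mulrN opprB.
Qed.

Lemma lipschitz_of_derive A c (K x y : R) : (forall z : R, is_derive z 1 A (c z)) ->
  (forall z, `|c z| <= K) -> `|A y - A x| <= K * `|y - x|.
Proof.
move=> dA cK; have [z _ ->] := mean_value x y dA.
by rewrite normrM ler_wpM2r.
Qed.

Lemma lipschitz_continuous (f : R -> R) (K : R) :
  (forall x y, `|f y - f x| <= K * `|y - x|) -> continuous f.
Proof.
move=> fK x; apply/cvgrPdist_lt => e e0; near=> y.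
rewrite distrC (le_lt_trans (fK _ _))//.
have K1 : 0 < `|K| + 1 by rewrite ltr_wpDl.
apply: (@le_lt_trans _ _ ((`|K| + 1) * `|y - x|)).
  by rewrite ler_wpM2r// (le_trans (ler_norm K))// lerDl.
rewrite -ltr_pdivlMl// mulrC distrC; near: y.
by apply: (@cvgr_dist_lt _ R^o _ _ _ id) => //; rewrite divr_gt0.
Unshelve. all: by end_near. Qed.

(* The normalization G' = 2 g makes dg the Ito drift G'' / 2 of G along a
   Brownian motion. *)
Lemma second_order_taylor (G g dg : R -> R) (K x u : R) :
  (forall z : R, is_derive z 1 G (2 * g z)) ->
  (forall z : R, is_derive z 1 g (dg z)) ->
  (forall y z, `|dg z - dg y| <= K * `|z - y|) ->
  `|G (x + u) - G x - 2 * g x * u - dg x * u ^+ 2| <= 2 * K * `|u| ^+ 3.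
Proof.
move=> dG dgP dgK.
(* The remainder as a function of the increment. The mean value theorem is applied to [psi] and then
   to [g], and the Lipschitz bound on [dg] does the work of a third derivative of [G]. *)
pose psi (v : R) := G (v + x) - G x - 2 * g x * v - dg x * v ^+ 2.
have dpsi (v : R) : is_derive v 1 psi (2 * (g (v + x) - g x - dg x * v)).
  have dGv : is_derive (v + x) 1 G (2 * g (v + x)) by [].
  have ds : is_derive v 1 (shift x) 1 := is_derive_shift _ _ _.
  rewrite (_ : psi = (G \o shift x) - cst (G x) - (2 * g x) \*: id -
    dg x \*: (id ^+ 2 : R -> R))//.
  apply: is_derive_eq; rewrite /GRing.scale/= /shift/=; ring.
have [z] := mean_value 0 u dpsi; rewrite !subr0 => zu E.
have {E} -> : G (x + u) - G x - 2 * g x * u - dg x * u ^+ 2 =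
    2 * (g (z + x) - g x - dg x * z) * u.
  rewrite -E /psi add0r (addrC x); ring.
have [y yz ->] := mean_value x (z + x) dgP.
rewrite addrK in yz *; rewrite -mulrBl !normrM normr_nat.
rewrite exprS expr2 -!mulrA ler_wpM2l//.
have K0 : 0 <= K.
  have := dgK 0 1; rewrite subr0 normr1 mulr1; exact: le_trans.
apply: (@le_trans _ _ (K * `|z| * (`|z| * `|u|))).
  by rewrite ler_wpM2r ?mulr_ge0// (le_trans (dgK _ _))// ler_wpM2l.
by rewrite -mulrA ler_wpM2l// ler_pM ?mulr_ge0// ler_wpM2r.
Qed.

Lemma continuous_itv_integrable c (a b : R) : continuous c ->
  mu.-integrable `[a, b] (EFin \o c).
Proof.
move=> cc; apply: continuous_compact_integrable; first exact: segment_compact.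
exact: continuous_subspaceT.
Qed.

Lemma Rintegral_primitive c A (a b : R) : continuous c ->
  (forall z : R, is_derive z 1 A (c z)) -> a <= b ->
  \int[mu]_(x in `[a, b]) c x = A b - A a.
Proof.
move=> cc dA; rewrite le_eqVlt => /predU1P[<-|ab].
  by rewrite set_itv1 Rintegral_set1 subrr.
rewrite /Rintegral (@continuous_FTC2 _ c A)//.
- exact: continuous_subspaceT.
- split.
  + by move=> z _; case: (dA z).
  + by apply: cvg_at_right_filter; exact: is_derive_continuous.
  + by apply: cvg_at_left_filter; exact: is_derive_continuous.
- by move=> z _; rewrite derive1E derive_val.
Qed.

(** Integrals from a fixed left end only give a primitive on a half-line. Here the left end - (|x| +
    1) moves with x; subtracting the value at 0 cancels its choice, so near x the function agrees
    with the one based at - (|x| + 2). *)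
Lemma primitive_exists c : continuous c ->
  exists A, forall x : R, is_derive x 1 A (c x).
Proof.
move=> cc; pose F (L x : R) := \int[mu]_(t in `[- L, x]) c t.
have dF (L x : R) : - L < x -> is_derive x 1 (F L) (c x).
  move=> Lx; have [] := @continuous_FTC1_closed _ c (- L) x (x + 1) _ _ Lx (cc x).
  - by rewrite ltrDl.
  - exact: continuous_itv_integrable.
  - by move=> dFx <-; rewrite derive1E; exact: derivableP.
have FB (L L' x : R) : L <= L' -> - L <= x -> F L x = F L' x - F L' (- L).
  move=> LL' Lx; rewrite /F Rintegral_itvB.
  - rewrite Rintegral_itv_obnd_cbnd//.
    apply: integrableS (continuous_itv_integrable (- L) x cc) => //.
    by apply: subset_itvr; rewrite bnd_simp.
  - exact: continuous_itv_integrable.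
  - by rewrite bnd_simp lerN2.
  - by rewrite bnd_simp.
pose A x := F (`|x| + 1) x - F (`|x| + 1) 0.
exists A => x; pose L := `|x| + 2.
have AE : \forall y \near x, F L y - F L 0 = A y.
  near=> y.
  have yL : `|y| + 1 <= L.
    rewrite /L; have : `|y - x| <= 1.
      by near: y; apply: filterS (nbhsx_ballx x 1 ltr01) => y; rewrite /ball/= distrC => /ltW.

    have := lerB_dist y x; lra.
  have y0 : - (`|y| + 1) <= 0 by rewrite oppr_le0 addr_ge0.
  have yy : - (`|y| + 1) <= y by have := ler_norm (- y); rewrite normrN; lra.
  by rewrite /A (FB _ _ _ yL y0) (FB _ _ _ yL yy); ring.
have dL : is_derive x 1 (fun y => F L y - F L 0) (c x).
  have xL : - L < x by rewrite /L; have := ler_norm (- x); rewrite normrN; lra.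
  have := dF _ _ xL => d1.
  rewrite (_ : (fun y => _) = (F L - cst (F L 0))) //.
  by apply: is_derive_eq; rewrite subr0.
by apply: near_eq_is_derive dL; rewrite ?oner_eq0//.
Unshelve. all: by end_near. Qed.

Lemma uniform_continuity c (a b e : R) : continuous c -> 0 < e ->
  exists2 r, 0 < r & forall x y, a <= x <= b -> `|y - x| < r -> `|c y - c x| < e.
Proof.
move=> cc e0.
have /compact_near_coveringP K : compact `[a, b] by exact: segment_compact.
have Kc := K R (0^'+) (fun r x => forall y, `|y - x| < r -> `|c y - c x| < e) _.
have near0 : \forall r \near 0^'+, `[a, b]%classic `<=`
    [set x | forall y, `|y - x| < r -> `|c y - c x| < e].
  apply: Kc => x _.
  have : \forall y \near x, `|c y - c x| < e / 2.
    have := cc x; move=> /cvgrPdist_lt /(_ (e / 2)); rewrite divr_gt0// => /(_ isT).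
    by apply: filterS => y; rewrite distrC.
  move=> /nbhs_ballP[r /= r0 xr].
  exists (ball x (r / 2), [set s | s < r / 2]) => /=.
    split; first by apply: nbhsx_ballx; rewrite divr_gt0.
    by apply: nbhs_right_lt => //; rewrite divr_gt0.
  move=> [z s] /= [xz sr] y zy; rewrite /ball/= in xz.
  have cz : `|c z - c x| < e / 2.
    by apply: xr; rewrite /ball/=; lra.
  have cy : `|c y - c x| < e / 2.
    apply: xr; rewrite /ball/=; have := ler_distD z x y.
    by rewrite (distrC z y); lra.
  by have := ler_distD (c x) (c y) (c z); rewrite (distrC (c x)); lra.
have [r [r0 rK]] := filter_ex (filterI (nbhs_right_gt (0 : R)) near0).
by exists r => // x y xab yx; apply: rK => //=; rewrite in_itv.
Qed.

Definition riemann_sum c (a b : R) (N : nat) : R :=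
  \sum_(i < N) (b - a) / N%:R * c (a + i%:R * ((b - a) / N%:R)).

(** On each cell the increment of a primitive is the mesh times a value of [c] in that cell, and
    uniform continuity compares this value with the one at the left end. *)
Lemma riemann_sum_near c (a b e : R) : continuous c -> a <= b -> 0 < e ->
  exists K : nat, forall N, (K < N)%N ->
    `|\int[mu]_(x in `[a, b]) c x - riemann_sum c a b N| <= e.
Proof.
move=> cc ab e0; have [A dA] := primitive_exists cc.
(* The summand 1 keeps the denominator positive when a = b. *)
have e'0 : 0 < e / (b - a + 1) by rewrite divr_gt0// ltr_wpDl ?subr_ge0.
have [r r0 rc] := uniform_continuity a b cc e'0.
exists (Num.truncn ((b - a) / r)) => N KN.
have N0 : 0 < N%:R :> R by rewrite ltr0n (leq_ltn_trans _ KN).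
rewrite (Rintegral_primitive cc dA ab); set h := (b - a) / N%:R.
have h0 : 0 <= h by rewrite divr_ge0 ?subr_ge0// ltW.
have Nh : N%:R * h = b - a by rewrite /h mulrC divfK// gt_eqF.
have hr : h < r.
  rewrite /h ltr_pdivrMr// -ltr_pdivrMl// mulrC.
  by rewrite (lt_le_trans (truncnS_gt _))// ler_nat.
have -> : A b - A a = \sum_(i < N) (A (a + i.+1%:R * h) - A (a + i%:R * h)).
  rewrite -(big_mkord xpredT (fun i => A (a + i.+1%:R * h) - A (a + i%:R * h))).
  by rewrite telescope_sumr// Nh mul0r addr0 subrKC.
rewrite /riemann_sum -/h -sumrB (le_trans (ler_norm_sum _ _ _))//.
have -> : e = e / (b - a + 1) * (b - a) + e / (b - a + 1).
  by field; rewrite gt_eqF// ltr_wpDl ?subr_ge0.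
apply: (@le_trans _ _ (\sum_(i < N) (e / (b - a + 1) * h))).
  apply: ler_sum => i _.
  have [z zi ->] := mean_value (a + i%:R * h) (a + i.+1%:R * h) dA.
  have ih : a + i.+1%:R * h - (a + i%:R * h) = h by rewrite -natr1; ring.
  rewrite ih mulrC -mulrBr normrM ger0_norm// mulrC ler_wpM2r// ltW// rc//.
    rewrite lerDl mulr_ge0//= -lerBrDl -Nh ler_wpM2r// ler_nat.
    exact: ltnW.
  by rewrite (le_lt_trans zi)// ih ger0_norm.
rewrite sumr_const card_ord -mulr_natr -mulrA (mulrC h) Nh lerDl; exact: ltW.
Qed.

(** Removes the discretization errors: C may depend on everything except N. *)
Lemma ler_of_div (x y C : R) :
  (forall N, (0 < N)%N -> x <= y + C / N%:R) -> x <= y.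
Proof.
move=> H; rewrite leNgt; apply/negP => yx.
have xy : 0 < x - y by rewrite subr_gt0.
have C1 : 0 <= `|C| / (x - y) by rewrite divr_ge0// ltW.
have := H _ (ltn0Sn (Num.truncn (`|C| / (x - y)))).
rewrite leNgt => /negP; apply.
rewrite -ltrBrDl ltr_pdivrMr ?ltr0n// (le_lt_trans (ler_norm C))//.
by rewrite -ltr_pdivrMl// mulrC truncnS_gt.
Qed.

End RealAnalysis.

(** * Moments of the Gaussian distribution *)

Section GaussianMoments.
Context (R : realType).
Notation mu := (@lebesgue_measure R).

Import HBNNSimple.

(** The density formula: by definition for indicators, by linearity for simple functions, by
    monotone convergence in general. *)
Lemma ge0_integral_normal_prob (m s : R) (f : measurableTypeR R -> \bar R) :
  measurable_fun setT f -> (forall x, 0 <= f x)%E ->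
  (\int[normal_prob m s]_x f x =
   \int[mu]_x (f x * (normal_pdf m s x)%:E))%E.
Proof.
move=> mf f0; have p0 x : (0 <= (normal_pdf m s x)%:E)%E.
  by rewrite lee_fin normal_pdf_ge0.
have mp : measurable_fun setT (fun x => (normal_pdf m s x)%:E).
  by apply/measurable_EFinP; exact: measurable_normal_pdf.
have fun_case (g : {nnsfun measurableTypeR R >-> R}) :
    (\int[normal_prob m s]_x (g x)%:E =
     \int[mu]_x ((g x)%:E * (normal_pdf m s x)%:E))%E.
  under [LHS]eq_integral do rewrite fimfunE -fsumEFin//.
  rewrite [LHS]ge0_integral_fsum//; last 2 first.
    - by move=> r; exact/measurable_EFinP/measurableT_comp.
    - by move=> n x _; rewrite EFinM nnfun_muleindic_ge0.
  under [RHS]eq_integral.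
    move=> x _; rewrite fimfunE -fsumEFin// muleC ge0_mule_fsumr; last first.
      by move=> r; rewrite EFinM nnfun_muleindic_ge0.
    over.
  rewrite [RHS]ge0_integral_fsum//; last 2 first.
    - move=> r; apply: emeasurable_funM => //.
      by apply/measurable_EFinP/measurableT_comp.
    - by move=> n x _; rewrite mule_ge0// EFinM nnfun_muleindic_ge0.
  apply: eq_fsbigr => r _.
  rewrite integralZl_indic_nnsfun// integral_indic// setIT.
  transitivity (r%:E * \int[mu]_(x in g @^-1` [set r]) (normal_pdf m s x)%:E)%E.
    by [].
  have [r0|r0] := leP 0 r; last first.
    rewrite preimage_nnfun0// integral_set0 mule0.
    rewrite integral0_eq// => x _.
    by rewrite indic0 /= mulr0 mule0.
  rewrite -ge0_integralZl//; last exact: measurable_funTS.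
  rewrite [LHS]integral_mkcond; apply: eq_integral => x _.
  rewrite patchE indicE; case: ifPn => xr.
    by rewrite mulr1 muleC.
  by rewrite mulr0 mule0.
pose f_ := nnsfun_approx measurableT mf.
transitivity (lim (\int[normal_prob m s]_x (f_ n x)%:E @[n --> \oo])%E).
  rewrite -monotone_convergence//=.
  - apply: eq_integral => ? /[!inE] xD; apply/esym/cvg_lim => //=.
    exact: cvg_nnsfun_approx.
  - by move=> n; apply/measurable_EFinP; exact: measurable_funPT.
  - by move=> n ? _; rewrite lee_fin.
  - by move=> ? _ ? ? mn; rewrite lee_fin; exact/lefP/nd_nnsfun_approx.
under eq_fun do rewrite fun_case.
rewrite -monotone_convergence//=.
- apply: eq_integral => x _; apply/cvg_lim => //=.
  under eq_fun do rewrite muleC.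
  rewrite (muleC (f x)).
  by apply: cvgeZl => //; exact: cvg_nnsfun_approx.
- by move=> n; apply: emeasurable_funM => //; apply/measurable_EFinP; exact: measurable_funPT.
- by move=> n x _; rewrite mule_ge0// lee_fin.
- move=> x _ n k nk; rewrite lee_wpmul2r// lee_fin.
  exact/lefP/nd_nnsfun_approx.
Qed.

Lemma normal_pdf0E (s x : R) : s != 0 ->
  normal_pdf 0 s x = normal_peak s * expR (- (x ^+ 2 / (s ^+ 2 *+ 2))).
Proof. by move=> s0; rewrite normal_pdfE// /normal_fun subr0 mulNr. Qed.

(** With u = x^2 / (4 s^2) the density carries exp(-2 u). One factor exp(-u) absorbs u^(n+1) at the
    price of (n+1)!, the other is below the exponential in the density of deviation 2 s; the factor
    2 is the ratio of the peaks. *)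
Lemma normal_pdf_pow_le (s x : R) (n : nat) : 0 < s ->
  x ^+ n.+1.*2 * normal_pdf 0 s x <=
  n.+1`!%:R * (4 * s ^+ 2) ^+ n.+1 * (2 * normal_pdf 0 (2 * s) x).
Proof.
move=> s0; have s2 : 0 < 2 * s by rewrite mulr_gt0.
rewrite !normal_pdf0E ?gt_eqF//.
have pk : normal_peak s = 2 * normal_peak (2 * s).
  rewrite /normal_peak (_ : (2 * s) ^+ 2 * pi *+ 2 = 2 ^+ 2 * (s ^+ 2 * pi *+ 2)).
    by rewrite sqrtrM ?sqr_ge0// sqrtr_sqr normr_nat invfM mulrA divff ?mul1r.
  by move: (@pi R) => p; ring.
set u := x ^+ 2 / (4 * s ^+ 2).
have u0 : 0 <= u by rewrite divr_ge0 ?sqr_ge0// mulr_ge0 ?sqr_ge0.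
have -> : x ^+ 2 / (s ^+ 2 *+ 2) = u + u.
  by rewrite /u -mulr_natr; field; rewrite gt_eqF.
have -> : x ^+ n.+1.*2 = (4 * s ^+ 2) ^+ n.+1 * u ^+ n.+1.
  rewrite -exprMn /u mulrC divfK ?gt_eqF// ?mulr_gt0 ?exprn_gt0//.
  by rewrite -mul2n exprM.
have un : u ^+ n.+1 <= n.+1`!%:R * expR u.
  rewrite -ler_pdivrMl ?ltr0n ?fact_gt0// mulrC.
  by apply: le_trans (expR_ge1Dxn n u0); rewrite lerDr.
have eu : expR (- u) <= expR (- (x ^+ 2 / ((2 * s) ^+ 2 *+ 2))).
  rewrite ler_expR lerN2 /u ler_wpM2l ?sqr_ge0// lef_pV2 ?posrE//.
  - by rewrite exprMn -mulr_natr; have := sqr_ge0 s; nra.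
  - by rewrite -mulr_natr mulr_gt0// exprn_gt0.
  - by rewrite mulr_gt0// exprn_gt0.
rewrite pk; set q := normal_peak _.
have q0 : 0 <= q by exact: normal_peak_ge0.
have S0 : 0 <= (4 * s ^+ 2) ^+ n.+1 by rewrite exprn_ge0// mulr_ge0// sqr_ge0.
have -> : (4 * s ^+ 2) ^+ n.+1 * u ^+ n.+1 * (2 * q * expR (- (u + u))) =
   ((4 * s ^+ 2) ^+ n.+1 * (2 * q)) * (u ^+ n.+1 * expR (- u) * expR (- u)).
  by rewrite opprD expRD; ring.
have -> : n.+1`!%:R * (4 * s ^+ 2) ^+ n.+1 *
    (2 * (q * expR (- (x ^+ 2 / ((2 * s) ^+ 2 *+ 2))))) =
   ((4 * s ^+ 2) ^+ n.+1 * (2 * q)) *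
     (n.+1`!%:R * expR (- (x ^+ 2 / ((2 * s) ^+ 2 *+ 2)))) by ring.
rewrite ler_wpM2l ?mulr_ge0// ler_pM ?expR_ge0//.
  by rewrite mulr_ge0 ?exprn_ge0 ?expR_ge0.
by rewrite expRN ler_pdivrMr ?expR_gt0.
Qed.

(** The constant is crude; only the power of s matters in the error estimates. The variance, needed
    exactly for the isometry, is computed separately. *)
Lemma normal_even_moment_le (s : R) (n : nat) : 0 < s ->
  (\int[normal_prob 0 s]_x (x ^+ n.+1.*2)%:E <=
   (2 * (n.+1`!%:R * (4 * s ^+ 2) ^+ n.+1))%:E)%E.
Proof.
move=> s0; rewrite ge0_integral_normal_prob; last 2 first.
- by apply/measurable_EFinP; exact: measurable_funX.
- by move=> x; rewrite lee_fin -mul2n exprM exprn_ge0// sqr_ge0.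
set K := n.+1`!%:R * _.
have K0 : 0 <= 2 * K.
  by rewrite !mulr_ge0// exprn_ge0// mulr_ge0// sqr_ge0.
apply: (@le_trans _ _ (\int[mu]_x ((2 * K)%:E * (normal_pdf 0 (2 * s) x)%:E))%E).
  apply: ge0_le_integral => //.
  - by move=> x _; rewrite -EFinM lee_fin mulr_ge0 ?normal_pdf_ge0// -mul2n exprM exprn_ge0// sqr_ge0.
  - apply/measurable_EFinP; apply: measurable_funM; last exact: measurable_normal_pdf.
    exact: measurable_funX.
  - apply/measurable_EFinP; apply: measurable_funM => //.
    exact: measurable_normal_pdf.
  - move=> x _; rewrite -!EFinM lee_fin (le_trans (normal_pdf_pow_le x n s0))//.
    by rewrite -/K mulrCA mulrA.
rewrite ge0_integralZl//; last 2 first.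
  - by apply/measurable_EFinP; exact: measurable_normal_pdf.
  - by move=> x _; rewrite lee_fin normal_pdf_ge0.
by rewrite integral_normal_pdf mule1.
Qed.

Lemma normal_pdf0N (s x : R) : s != 0 ->
  normal_pdf 0 s (- x) = normal_pdf 0 s x.
Proof. by move=> s0; rewrite !normal_pdf0E// sqrrN. Qed.

Lemma is_derive_normal_pdf0 (s x : R) : s != 0 ->
  is_derive x 1 (normal_pdf 0 s) (- (x / s ^+ 2) * normal_pdf 0 s x).
Proof.
move=> s0; rewrite (_ : normal_pdf 0 s =
    (fun x => normal_peak s * expR (- (x ^+ 2 / (s ^+ 2 *+ 2))))); last first.
  by apply/funext => y; rewrite normal_pdf0E.
have d1 : is_derive x 1 (fun y : R => - (y ^+ 2 / (s ^+ 2 *+ 2))) (- (x / s ^+ 2)).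
  rewrite (_ : (fun y : R => _) = (- (s ^+ 2 *+ 2)^-1) \*: (id ^+ 2 : R -> R)).
    apply: is_derive_eq; rewrite /= -mulr_natr !scaler1 /GRing.scale/=.
    by field; rewrite s0.
  by apply/funext => y /=; rewrite /GRing.scale/= mulrC mulNr.
rewrite (_ : (fun y : R => _) = normal_peak s \*:
    (expR \o (fun y : R => - (y ^+ 2 / (s ^+ 2 *+ 2)))))//.
by apply: is_derive_eq; rewrite /GRing.scale/=; ring.
Qed.

(** Integration by parts: since p' = - x p / s^2, a primitive of x^2 p is s^2 (A - x p) with A a
    primitive of p. On the half-line x p vanishes at both ends, so the integral is s^2 times that of
    p; symmetry gives the whole line. *)
Lemma normal_second_moment (s : R) : 0 < s ->
  (\int[normal_prob 0 s]_x (x ^+ 2)%:E = (s ^+ 2)%:E)%E.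
Proof.
move=> s0; have sn0 : s != 0 by rewrite gt_eqF.
set p := normal_pdf 0 s.
have p0 x : 0 <= p x by exact: normal_pdf_ge0.
have cp : continuous p by exact: continuous_normal_pdf.
have [A dA] := primitive_exists cp.
have cA : continuous A by move=> x; exact: is_derive_continuous.
have ndA : nondecreasing_fun A.
  move=> x y xy; have [z _ E] := mean_value x y dA.
  by rewrite -subr_ge0 E mulr_ge0// subr_ge0.
(* Increments of A from 0 are partial masses of the density, at most 1. *)
have ubA : has_ubound (range A).
  exists (A 0 + 1) => _ [x _ <-]; have [x0|/ltW x0] := leP 0 x; last first.
    by rewrite (le_trans (ndA _ _ x0))// lerDl.
  rewrite -lerBlDl -(Rintegral_primitive cp dA x0).
  rewrite -lee_fin -(@integral_normal_pdf _ 0 s) -/p.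
  rewrite /Rintegral fineK; last first.
    exact/integrable_fin_num/continuous_itv_integrable.
  apply: ge0_subset_integral => //.
  - by apply/measurable_EFinP; exact: measurable_normal_pdf.
  - by move=> z _; rewrite lee_fin.
have := nondecreasing_cvgr ndA ubA; set l := sup _ => Al.
have right_cont (F : R -> R) : continuous F -> F x @[x --> 0^'+] --> F 0.
  by move=> cF; apply: cvg_at_right_filter; exact: cF.
have Ip : (\int[mu]_(x in `[0%R, +oo[) (p x)%:E = l%:E - (A 0)%:E)%E.
  apply: ge0_continuous_FTC2y => //.
  - exact: continuous_subspaceT.
  - exact: right_cont.
  - by move=> x _; rewrite derive1E derive_val.
have Ixxp : (\int[mu]_(x in `[0%R, +oo[) (x ^+ 2 * p x)%:E =
    (s ^+ 2 * l)%:E - (s ^+ 2 * A 0)%:E)%E.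
  pose F (x : R) := s ^+ 2 * (A x - x * p x).
  have dF (x : R) : is_derive x 1 F (x ^+ 2 * p x).
    have dp : is_derive x 1 p _ := is_derive_normal_pdf0 x sn0.
    rewrite (_ : F = (s ^+ 2) \*: (A - id * p))//.
    apply: is_derive_eq; rewrite /GRing.scale/= -/p.
    by field; rewrite sn0.
  have cF : continuous F by move=> x; exact: is_derive_continuous (dF x).
  rewrite (_ : s ^+ 2 * A 0 = F 0); last by rewrite /F mul0r subr0.
  apply: ge0_continuous_FTC2y => //.
  - by move=> x _; rewrite mulr_ge0// sqr_ge0.
  - apply: continuous_subspaceT => x; apply: cvgM; last exact: cp.
    exact: exprn_continuous.
  - apply: cvgMr; rewrite -[l]subr0; apply: cvgB => //.
    (* x^2 p is bounded by K, hence x p is at most K / x. *)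
    pose K := 1`!%:R * (4 * s ^+ 2) ^+ 1 * (2 * normal_peak (2 * s)).
    apply: (@squeeze_cvgr _ _ _ _ (fun=> 0) (fun x => K / x)).
    + near=> x; have x0 : 0 < x by near: x; exact: nbhs_pinfty_gt.
      rewrite mulr_ge0 ?(ltW x0)//= ler_pdivlMr// mulrAC -expr2.
      rewrite (le_trans (normal_pdf_pow_le x 0 s0))//.
      rewrite ler_wpM2l//; first by rewrite mulr_ge0// exprn_ge0// mulr_ge0// sqr_ge0.
      by rewrite ler_wpM2l// normal_pdf_ub// gt_eqF// mulr_gt0.
    + exact: cvg_cst.
    + rewrite -[X in _ --> X](mulr0 K); apply: cvgMr.
      by apply/gtr0_cvgV0; [near=> x; near: x; exact: nbhs_pinfty_gt|exact: cvg_id].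
  - exact: right_cont.
  - by move=> x _; rewrite derive1E derive_val.
rewrite ge0_integral_normal_prob; last 2 first.
- by apply/measurable_EFinP; exact: measurable_funX.
- by move=> x; rewrite lee_fin sqr_ge0.
have := @integral_normal_pdf _ 0 s; rewrite -/p.
rewrite ge0_symfun_integralT//; last first.
  by move=> x; rewrite /= /p normal_pdf0N.
rewrite -set_itvcy Ip -EFinB -EFinM => -[lA].
under eq_integral do rewrite -EFinM -/p.
rewrite (@ge0_symfun_integralT _ (fun x => x ^+ 2 * p x)); last 3 first.
- by move=> x; rewrite mulr_ge0// sqr_ge0.
- move=> x; apply: cvgM; last exact: cp.
  exact: exprn_continuous.
- by move=> x; rewrite /= /p sqrrN normal_pdf0N.
rewrite -set_itvcy Ixxp -EFinB -EFinM; congr EFin.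
by rewrite -mulrBr mulrCA lA mulr1.
Unshelve. all: by end_near. Qed.

Lemma square_integrable_normal (s : R) : 0 < s ->
  square_integrable (normal_prob 0 s) (fun x : measurableTypeR R => x).
Proof.
move=> s0; split => //; apply/integrableP; split.
  by apply/measurable_EFinP; exact: measurable_funX.
under eq_integral do rewrite /= ger0_norm ?sqr_ge0//.
by rewrite normal_second_moment// ltry.
Qed.

(** Reflection exchanges the integrals of the positive and negative parts; they are finite, so their
    difference is 0. *)
Lemma normal_mean (s : R) : 0 < s -> (\int[normal_prob 0 s]_x x%:E = 0)%E.
Proof.
move=> s0; have sn0 : s != 0 by rewrite gt_eqF.
set p := normal_pdf 0 s.
have p0 x : 0 <= p x by exact: normal_pdf_ge0.
have cp : continuous p by exact: continuous_normal_pdf.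
have mid : measurable_fun setT (fun x : measurableTypeR R => x%:E).
  exact/measurable_EFinP.
have ix : (normal_prob 0 s).-integrable setT (fun x : measurableTypeR R => x%:E).
  have := @square_integrable_integrable _ _ _ (normal_prob 0 s) idfun; apply.
  exact: square_integrable_normal.
rewrite integralE.
have Epos : (\int[normal_prob 0 s]_x ((EFin : R -> \bar R)^\+ x) =
    \int[mu]_(x in `[0%R, +oo[) (x * p x)%:E)%E.
  rewrite ge0_integral_normal_prob//; last exact: measurable_funepos.
  rewrite [RHS]integral_mkcond; apply: eq_integral => x _.
  rewrite patchE funeposE mem_setE in_itv/= andbT; case: ifPn => x0.
    by rewrite (max_idPl _)// lee_fin.
  by rewrite (max_idPr _) ?mul0e// lee_fin ltW// ltNge.
have Eneg : (\int[normal_prob 0 s]_x ((EFin : R -> \bar R)^\- x) =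
    \int[mu]_(x in `]-oo, 0%R]) (- x * p x)%:E)%E.
  rewrite ge0_integral_normal_prob//; last exact: measurable_funeneg.
  rewrite [RHS]integral_mkcond; apply: eq_integral => x _.
  rewrite patchE funenegE mem_setE in_itv/=; case: ifPn => x0.
    by rewrite (max_idPl _)// lee_fin oppr_ge0.
  by rewrite (max_idPr _) ?mul0e// lee_fin oppr_le0 ltW// ltNge.
rewrite Epos Eneg.
have := @ge0_integration_by_substitutionNy _ (fun x => - x * p x) 0.
rewrite oppr0 => ->; last 2 first.
- apply: continuous_subspaceT => x; apply: cvgM; last exact: cp.
  exact: opp_continuous.
- move=> x; rewrite in_itv/= => x0.
  by rewrite mulr_ge0// oppr_ge0 ltW.
under [X in (_ - X)%E]eq_integral do rewrite /= opprK /p normal_pdf0N//.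
rewrite subee// -Epos; apply: integrable_pos_fin_num => //.
Qed.

End GaussianMoments.

(** * Brownian motion along a grid *)

Section BrownianMotion.
Context (R : realType) d (T : measurableType d) (P : probability T R).
Variable omega : R -> T -> 'rV[R]_2.
Hypothesis bm : brownian_motion P omega.

(* Started exactly at 0, whereas omega only starts at 0 almost surely. *)
Definition motion (i : 'I_2) (t : R) (w : T) : R := omega t w 0 i - omega 0 w 0 i.

Local Notation B := (motion 0).
Local Notation W := (motion 1).

Lemma motion0 i w : motion i 0 w = 0.
Proof. by rewrite /motion subrr. Qed.

Lemma measurable_motion i (t : R) : 0 <= t -> measurable_fun setT (motion i t).
Proof. by move=> t0; apply: measurable_funB; exact: (bm_process bm). Qed.

Lemma motion_incrE i (s t : R) w :
  motion i t w - motion i s w = omega t w 0 i - omega s w 0 i.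
Proof. by rewrite /motion opprB addrA subrK. Qed.

Lemma ge0_integral_increment i (s t : R) (f : R -> \bar R) :
  0 <= s -> s < t -> measurable_fun setT f -> (forall x, 0 <= f x)%E ->
  (\int[P]_w f (motion i t w - motion i s w)%R =
   \int[normal_prob 0 (Num.sqrt (t - s))]_x f x)%E.
Proof.
move=> s0 st mf f0.
have mX : measurable_fun setT (fun w => motion i t w - motion i s w).
  by apply: measurable_funB; apply: measurable_motion => //; rewrite (le_trans s0)// ltW.
have := @ge0_integral_pushforward _ _ _ (measurableTypeR R) _ _ mX P setT f.
rewrite preimage_setT => <- //.
apply: (@eq_measure_integral _ (measurableTypeR R) R) => A mA _.
rewrite /pushforward/=.
rewrite -(bm_gaussian bm s0 st i mA); congr (P _).
by apply/funext => w; rewrite /preimage/= motion_incrE.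
Qed.

Lemma increment_even_moment i (s t : R) (n : nat) : 0 <= s -> s <= t ->
  P.-integrable setT (EFin \o (fun w => (motion i t w - motion i s w) ^+ n.+1.*2)) /\
  \int[P]_w ((motion i t w - motion i s w) ^+ n.+1.*2) <=
    2 * (n.+1`!%:R * (4 * (t - s)) ^+ n.+1).
Proof.
move=> s0; rewrite le_eqVlt => /predU1P[<-|st].
  have -> : (fun w => (motion i s w - motion i s w) ^+ n.+1.*2) = fun=> 0.
    by apply/funext => w; rewrite subrr doubleS expr0n.
  split; first exact: finite_measure_integrable_cst.
  by rewrite Rintegral_cst// mul0r subrr mulr0 expr0n/= !mulr0.
have ts0 : 0 < t - s by rewrite subr_gt0.
have even_ge0 (x : R) : 0 <= x ^+ n.+1.*2 by rewrite -mul2n exprM exprn_ge0// sqr_ge0.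
have mX : measurable_fun setT (fun w => motion i t w - motion i s w).
  by apply: measurable_funB; apply: measurable_motion => //; rewrite (le_trans s0)// ltW.
have := @ge0_integral_increment i s t (fun x => (x ^+ n.+1.*2)%:E) s0 st.
have /[swap]/[apply] : measurable_fun [set: R] (fun x : R => (x ^+ n.+1.*2)%:E).
  by apply/measurable_EFinP; exact: measurable_funX.
have h x : (0 <= (x ^+ n.+1.*2 : R)%:E)%E by rewrite lee_fin.
move=> /(_ h) E.
have bnd : (\int[P]_w ((motion i t w - motion i s w) ^+ n.+1.*2)%:E <=
    (2 * (n.+1`!%:R * (4 * (t - s)) ^+ n.+1))%:E)%E.
  rewrite E -[in leRHS](sqr_sqrtr (ltW ts0)).
  by apply: normal_even_moment_le; rewrite sqrtr_gt0.
have iX : P.-integrable setT (EFin \o (fun w => (motion i t w - motion i s w) ^+ n.+1.*2)).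
  apply/integrableP; split.
    by apply/measurable_EFinP; exact: measurable_funX.
  under eq_integral do rewrite /= ger0_norm//.
  by rewrite (le_lt_trans bnd)// ltry.
by split => //; rewrite -lee_fin fineK//; exact: integrable_fin_num.
Qed.

Lemma square_integrable_increment i (s t : R) : 0 <= s -> s <= t ->
  square_integrable P (fun w => motion i t w - motion i s w).
Proof.
move=> s0 st; split.
  by apply: measurable_funB; apply: measurable_motion => //; rewrite (le_trans s0).
exact: (increment_even_moment i 0 s0 st).1.
Qed.

Lemma square_integrable_motion i (t : R) : 0 <= t ->
  square_integrable P (motion i t).
Proof.
move=> t0; have := square_integrable_increment i (lexx 0) t0.
by under eq_fun do rewrite motion0 subr0.
Qed.

Lemma second_moment_increment i (s t : R) : 0 <= s -> s <= t ->
  second_moment P (fun w => motion i t w - motion i s w) = t - s.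
Proof.
move=> s0; rewrite le_eqVlt => /predU1P[<-|st].
  rewrite subrr /second_moment.
  by under eq_Rintegral do rewrite subrr expr0n; rewrite Rintegral_cst// mul0r.
have ts0 : 0 < t - s by rewrite subr_gt0.
rewrite /second_moment /Rintegral.
rewrite (ge0_integral_increment i (f := fun x => (x ^+ 2)%:E))//.
- by rewrite normal_second_moment ?sqrtr_gt0//= sqr_sqrtr// ltW.
- by apply/measurable_EFinP; exact: measurable_funX.
- by move=> x; rewrite lee_fin sqr_ge0.
Qed.

Lemma second_moment_motion i (t : R) : 0 <= t -> second_moment P (motion i t) = t.
Proof.
move=> t0; have := second_moment_increment i (lexx 0) t0.
by under eq_fun do rewrite motion0 subr0; rewrite subr0.
Qed.

Lemma increment_mean i (s t : R) : 0 <= s -> s <= t ->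
  \int[P]_w (motion i t w - motion i s w) = 0.
Proof.
move=> s0; rewrite le_eqVlt => /predU1P[<-|st].
  by under eq_Rintegral do rewrite subrr; rewrite Rintegral_cst// mul0r.
have ts0 : 0 < t - s by rewrite subr_gt0.
have mid : measurable_fun setT (fun x : R => x%:E) by exact/measurable_EFinP.
rewrite /Rintegral integralE.
have -> : ((fun w => (motion i t w - motion i s w)%:E)^\+ =
    fun w => (EFin : R -> \bar R)^\+ (motion i t w - motion i s w)%R)%E.
  by apply/funext => w; rewrite !funeposE.
have -> : ((fun w => (motion i t w - motion i s w)%:E)^\- =
    fun w => (EFin : R -> \bar R)^\- (motion i t w - motion i s w)%R)%E.
  by apply/funext => w; rewrite !funenegE.
rewrite !ge0_integral_increment//.
- by rewrite -integralE normal_mean// sqrtr_gt0.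
- exact: measurable_funeneg.
- exact: measurable_funepos.
Qed.

(** A single form of independence serving every orthogonality below: the times u1, u2, s accommodate
    a product of two martingale increments, and W_t, although t >= v, is independent of the
    increment as part of the other coordinate. *)
Lemma Rintegral_past_increment (u1 u2 s v t : R) (F : R * (R * (R * R)) -> R)
    (psi : R -> R) :
  0 <= u1 -> u1 <= u2 -> u2 <= s -> s <= v -> v <= t ->
  measurable_fun setT F -> measurable_fun setT psi ->
  square_integrable P (fun w => F (B u1 w, (B u2 w, (B s w, W t w)))) ->
  square_integrable P (fun w => psi (B v w - B s w)) ->
  \int[P]_w (F (B u1 w, (B u2 w, (B s w, W t w))) * psi (B v w - B s w)) =
  (\int[P]_w F (B u1 w, (B u2 w, (B s w, W t w)))) *
  (\int[P]_w psi (B v w - B s w)).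
Proof.
move=> u10 u12 u2s sv vt mF mpsi sF spsi.
(* The default [t] of [nth] supplies the sixth time, and keeps the sequence constant from there
   on. *)
pose tau := nth t [:: 0; u1; u2; s; v].
have tau0 : 0 <= tau 0%N by [].
have tauS k : tau k <= tau k.+1.
  by case: k => [|[|[|[|[|[|k]]]]]] //=; rewrite /tau /= ?nth_nil//.
have tau_ge0 k : 0 <= tau k by elim: k => // k /le_trans; apply.
pose X (p : 'I_5 * 'I_2) w := omega (tau p.1.+1) w 0 p.2 - omega (tau p.1) w 0 p.2.
have iX : mutually_independent P X := bm_independent bm tau0 tauS (n := 5).
have mX p : measurable_fun setT (X p).
  by apply: measurable_funB; apply: (bm_process bm).
(* Index 3 is the step from [tau 3] = s to [tau 4] = v. All other steps of B up to s, and all five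
   steps of W, remain available to F. *)
pose p0 : 'I_5 * 'I_2 := (inord 3, 0).
have mq k i : (k < 5)%N -> (k != 3) || (i != 0) ->
    measurable_fun (setT : set (g_sigma_algebraType (cylinders_without X p0)))
      (fun w => omega (tau k.+1) w 0 i - omega (tau k) w 0 i).
  move=> k5 ki; have := @measurable_family _ _ _ _ X p0 (inord k, i).
  rewrite /X/= inordK//; apply.
  by rewrite xpair_eqE negb_and -val_eqE /= !inordK.
have m1 : measurable_fun (setT : set (g_sigma_algebraType (cylinders_without X p0)))
    (B u1) by exact: (mq 0%N 0).
have m2 : measurable_fun (setT : set (g_sigma_algebraType (cylinders_without X p0)))
    (B u2).
  rewrite (_ : B u2 = fun w => B u1 w + (omega (tau 2) w 0 0 - omega (tau 1) w 0 0)).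
    by apply: measurable_funD => //; exact: (mq 1%N 0).
  by apply/funext => w; rewrite /motion /tau/=; ring.
have m3 : measurable_fun (setT : set (g_sigma_algebraType (cylinders_without X p0)))
    (B s).
  rewrite (_ : B s = fun w => B u2 w + (omega (tau 3) w 0 0 - omega (tau 2) w 0 0)).
    by apply: measurable_funD => //; exact: (mq 2%N 0).
  by apply/funext => w; rewrite /motion /tau/=; ring.
have m4 : measurable_fun (setT : set (g_sigma_algebraType (cylinders_without X p0)))
    (W t).
  rewrite (_ : W t = fun w =>
    (omega (tau 1) w 0 1 - omega (tau 0) w 0 1) +
    ((omega (tau 2) w 0 1 - omega (tau 1) w 0 1) +
    ((omega (tau 3) w 0 1 - omega (tau 2) w 0 1) +
    ((omega (tau 4) w 0 1 - omega (tau 3) w 0 1) +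
     (omega (tau 5) w 0 1 - omega (tau 4) w 0 1))))).
    do 4 (apply: measurable_funD; first exact: (mq _ 1)).
    exact: (mq 4%N 1).
  by apply/funext => w; rewrite /motion /tau/=; ring.
have E w : B v w - B s w = X p0 w by rewrite motion_incrE /X/= inordK.
under eq_Rintegral do rewrite E.
under [X in _ = _ * X]eq_Rintegral do rewrite E.
apply: (Rintegral_independent_family mX iX) => //; last first.
  by move: spsi; under eq_fun do rewrite E.
apply: measurableT_comp => //; apply: measurable_fun_pair => //.
by apply: measurable_fun_pair => //; exact: measurable_fun_pair.
Qed.

Definition grid (a t : R) (N i : nat) : R := a + i%:R * ((t - a) / N%:R).

(** * Martingale increments and Ito sums on a uniform grid *)

Section Grid.
Variables (a t : R) (N : nat).
Hypotheses (a0 : 0 <= a) (at_ : a <= t) (N0 : (0 < N)%N).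

Local Notation dt := ((t - a) / N%:R).
Local Notation s := (grid a t N).
Local Notation D i w := (B (s i.+1) w - B (s i) w).

Lemma mesh_ge0 : 0 <= dt.
Proof. by rewrite divr_ge0// subr_ge0. Qed.

Lemma mesh_sum : N%:R * dt = t - a.
Proof. by rewrite mulrC divfK// pnatr_eq0 -lt0n. Qed.

Lemma grid_ge0 i : 0 <= s i.
Proof. by rewrite addr_ge0// mulr_ge0// mesh_ge0. Qed.

Lemma grid_gea i : a <= s i.
Proof. by rewrite lerDl mulr_ge0// mesh_ge0. Qed.

Lemma grid_le i j : (i <= j)%N -> s i <= s j.
Proof. by move=> ij; rewrite lerD2l ler_wpM2r ?mesh_ge0// ler_nat. Qed.

Lemma gridS i : s i.+1 - s i = dt.
Proof. by rewrite /grid -natr1; ring. Qed.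

Lemma grid0 : s 0%N = a.
Proof. by rewrite /grid mul0r addr0. Qed.

Lemma gridN : s N = t.
Proof. by rewrite /grid mesh_sum addrC subrK. Qed.

Lemma measurable_fun_motion (phi : R -> R) i (u : R) : 0 <= u ->
  measurable_fun setT phi -> measurable_fun setT (fun w => phi (motion i u w)).
Proof. by move=> u0 mphi; apply: measurableT_comp => //; exact: measurable_motion. Qed.

Section MartingaleIncrements.
Variables (phi psi : R -> R) (K : R).
Hypotheses (mphi : measurable_fun setT phi) (phiK : forall x, `|phi x| <= K)
  (mpsi : measurable_fun setT psi)
  (sqi_psi : forall i, square_integrable P (fun w => psi (D i w))).

(** [psi] is the identity for Ito sums and x^2 - dt for compensated squares; boundedness of [phi]
    keeps the products square-integrable. *)
Lemma martingale_increment_sqi i :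
  square_integrable P (fun w => phi (B (s i) w) * psi (D i w)).
Proof.
apply: (square_integrable_boundedM (c := K)) => //.
exact: (measurable_fun_motion _ (grid_ge0 _) mphi).
Qed.

(** The last increment is independent of the three other factors, all determined by time [s j], and
    has mean 0. *)
Lemma martingale_increment_orthogonal i j : (i < j)%N ->
  \int[P]_w psi (D j w) = 0 ->
  \int[P]_w ((phi (B (s i) w) * psi (D i w)) * (phi (B (s j) w) * psi (D j w))) = 0.
Proof.
move=> ij psi0.
pose F (z : R * (R * (R * R))) := (phi z.1 * psi (z.2.1 - z.1)) * phi z.2.2.1.
have mF : measurable_fun setT F.
  apply: measurable_funM; last by do 3 apply: measurableT_comp => //.
  apply: measurable_funM; first exact: measurableT_comp.
  apply: measurableT_comp => //; apply: measurable_funB => //.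
  exact: measurableT_comp.
have := @Rintegral_past_increment (s i) (s i.+1) (s j) (s j.+1) (s j.+1) F psi
  (grid_ge0 i) (grid_le (leqnSn i)) (grid_le ij) (grid_le (leqnSn j)) (lexx _) mF mpsi.
rewrite psi0 mulr0 => <-//.
- by apply: eq_Rintegral => w _; rewrite /F/=; ring.
- rewrite /F/=; under eq_fun do rewrite mulrC.
  apply: (square_integrable_boundedM (c := K)) => //.
    exact: (measurable_fun_motion _ (grid_ge0 _) mphi).
  exact: martingale_increment_sqi.
Qed.

Lemma martingale_increment_past_orthogonal i (u : R) (q : R -> R) :
  0 <= u -> u <= s i -> measurable_fun setT q ->
  square_integrable P (fun w => q (B u w)) ->
  \int[P]_w psi (D i w) = 0 ->
  \int[P]_w (q (B u w) * (phi (B (s i) w) * psi (D i w))) = 0.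
Proof.
move=> u0 us mq sq psi0.
pose F (z : R * (R * (R * R))) := phi z.2.2.1 * q z.2.1.
have mF : measurable_fun setT F.
  by apply: measurable_funM; do ! apply: measurableT_comp => //.
have := @Rintegral_past_increment u u (s i) (s i.+1) (s i.+1) F psi
  u0 (lexx _) us (grid_le (leqnSn i)) (lexx _) mF mpsi.
rewrite psi0 mulr0 => <-//.
- by apply: eq_Rintegral => w _; rewrite /F/=; ring.
- apply: (square_integrable_boundedM (c := K)) => //.
  exact: (measurable_fun_motion _ (grid_ge0 _) mphi).
Qed.

(** W at the later time u does not belong to the past of the increment; the independence of the two
    coordinates takes over. *)
Lemma martingale_increment_second_coordinate i (u : R) :
  s i.+1 <= u -> \int[P]_w psi (D i w) = 0 ->
  \int[P]_w (W u w * (phi (B (s i) w) * psi (D i w))) = 0.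
Proof.
move=> su psi0.
have u0 : 0 <= u := le_trans (grid_ge0 _) su.
pose F (z : R * (R * (R * R))) := phi z.2.2.1 * z.2.2.2.
have mF : measurable_fun setT F.
  by apply: measurable_funM; do ! apply: measurableT_comp => //.
have := @Rintegral_past_increment 0 0 (s i) (s i.+1) u F psi
  (lexx _) (lexx _) (grid_ge0 i) (grid_le (leqnSn i)) su mF mpsi.
rewrite psi0 mulr0 => <-//.
- by apply: eq_Rintegral => w _; rewrite /F/=; ring.
- apply: (square_integrable_boundedM (c := K)) => //.
    exact: (measurable_fun_motion _ (grid_ge0 _) mphi).
  exact: square_integrable_motion.
Qed.

End MartingaleIncrements.

Lemma increment_sqi i : square_integrable P (fun w => D i w).
Proof. exact: (square_integrable_increment 0 (grid_ge0 i) (grid_le (leqnSn i))). Qed.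

Definition ito_sum (phi : R -> R) (w : T) : R :=
  \sum_(i < N) phi (B (s i) w) * D i w.

Lemma ito_sum_sqi (phi : R -> R) (K : R) : measurable_fun setT phi ->
  (forall x, `|phi x| <= K) -> square_integrable P (ito_sum phi).
Proof.
move=> mphi phiK; apply: square_integrable_sum => i.
exact: (martingale_increment_sqi (psi := idfun) mphi phiK increment_sqi).
Qed.

(** Orthogonality leaves the diagonal, where each squared increment is independent of its
    coefficient and has mean dt. *)
Lemma ito_isometry (phi : R -> R) (K : R) : measurable_fun setT phi ->
  (forall x, `|phi x| <= K) ->
  second_moment P (ito_sum phi) =
  \sum_(i < N) dt * \int[P]_w (phi (B (s i) w) ^+ 2).
Proof.
move=> mphi phiK.
rewrite (@second_moment_orthogonal_sum _ _ _ P N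
  (fun i w => phi (B (s i) w) * D i w)); last 2 first.
- move=> i.
  exact: (martingale_increment_sqi (psi := idfun) mphi phiK increment_sqi).
- move=> i j ij.
  apply: (martingale_increment_orthogonal (psi := idfun) mphi phiK (@measurable_id _ _ _) increment_sqi) => //.
  exact: (increment_mean 0 (grid_ge0 j) (grid_le (leqnSn j))).
apply: eq_bigr => i _.
pose F (z : R * (R * (R * R))) := phi z.2.2.1 ^+ 2.
have mF : measurable_fun setT F.
  by apply: measurable_funX; do ! apply: measurableT_comp => //.
rewrite -(gridS i) -(second_moment_increment 0 (grid_ge0 i) (grid_le (leqnSn i))).
have mX2 : measurable_fun setT (fun x : R => x ^+ 2) by exact: measurable_funX.
have E := @Rintegral_past_increment 0 0 (s i) (s i.+1) (s i.+1) F (fun x => x ^+ 2)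
  (lexx _) (lexx _) (grid_ge0 i) (grid_le (leqnSn i)) (lexx _) mF mX2.
rewrite [RHS]mulrC /second_moment -[RHS]E.
- by apply: eq_Rintegral => w _; rewrite /F/=; ring.
- apply: (@square_integrable_bounded _ _ _ P (K ^+ 2)).
    by apply: measurable_funX; exact: (measurable_fun_motion _ (grid_ge0 _) mphi).
  move=> w; rewrite ger0_norm ?sqr_ge0// -[leLHS]real_normK ?num_real//.
  by rewrite ler_pXn2r ?nnegrE// (le_trans (normr_ge0 (phi 0))).
- split.
    by apply: measurable_funX; case: (increment_sqi i).
  have := (increment_even_moment 0 1 (grid_ge0 i) (grid_le (leqnSn i))).1.
  by under eq_fun do rewrite -[(1.+1).*2]/(2 * 2)%N exprM.
Qed.

Lemma ito_sum_second_moment_le (phi : R -> R) (K : R) :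
  measurable_fun setT phi -> (forall x, `|phi x| <= K) ->
  second_moment P (ito_sum phi) <= K ^+ 2 * (t - a).
Proof.
move=> mphi phiK; rewrite (ito_isometry mphi phiK).
have K0 : 0 <= K := le_trans (normr_ge0 _) (phiK 0).
apply: (@le_trans _ _ (\sum_(i < N) dt * K ^+ 2)); last first.
  by rewrite sumr_const card_ord -[leLHS]mulr_natl mulrA mesh_sum mulrC.
apply: ler_sum => i _; rewrite ler_wpM2l ?mesh_ge0//.
rewrite -[leRHS]mulr1 -[1]/(fine 1%E) -(@probability_setT _ _ _ P).
rewrite -(Rintegral_cst _ measurableT); apply: le_Rintegral => //.
- apply: (@square_integrable_bounded _ _ _ P K _ _ _).2; last by move=> w; exact: phiK.
  exact: (measurable_fun_motion _ (grid_ge0 _) mphi).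
- exact: finite_measure_integrable_cst.
- move=> w _; rewrite -[leLHS]real_normK ?num_real//.
  by rewrite ler_pXn2r ?nnegrE.
Qed.

(** * Ito's formula on the grid, with an error estimate *)

Section DiscreteIto.
Variables (G g dg : R -> R) (K A1 A2 : R).
Hypotheses (dG : forall z : R, is_derive z 1 G (2 * g z))
  (dgP : forall z : R, is_derive z 1 g (dg z))
  (dgA1 : forall z, `|dg z| <= A1)
  (dgA2 : forall y z, `|dg z - dg y| <= A2 * `|z - y|).

(** The defect in Ito's formula for [G], whose drift G'' / 2 is [dg]. *)
Definition ito_error (w : T) : R :=
  \sum_(i < N) dt * dg (B (s i) w) -
  (G (B t w) - G (B a w) - 2 * ito_sum g w).

Let taylor_remainder i w :=
  G (B (s i.+1) w) - G (B (s i) w) - 2 * g (B (s i) w) * D i w -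
  dg (B (s i) w) * D i w ^+ 2.

Let mG : measurable_fun setT G.
Proof.
apply: continuous_measurable_fun => x; exact: is_derive_continuous (dG x).
Qed.

Let mg : measurable_fun setT g.
Proof.
apply: continuous_measurable_fun => x; exact: is_derive_continuous (dgP x).
Qed.

Let mdg : measurable_fun setT dg.
Proof. exact: continuous_measurable_fun (lipschitz_continuous dgA2). Qed.

Let mB i : measurable_fun setT (B (s i)).
Proof. exact/measurable_motion/grid_ge0. Qed.

Let A2_ge0 : 0 <= A2.
Proof. by have := dgA2 0 1; rewrite subr0 normr1 mulr1; exact: le_trans. Qed.

(** The square of the cube is a sixth moment, whose even power removes the absolute value; 768 = 2 *
    3! * 4^3. *)
Let cube_sqi i : square_integrable P (fun w => `|D i w| ^+ 3) /\
  second_moment P (fun w => `|D i w| ^+ 3) <= 768 * dt ^+ 3.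
Proof.
have := increment_even_moment 0 2 (grid_ge0 i) (grid_le (leqnSn i)).
rewrite gridS /second_moment /square_integrable.
have E w : (`|D i w| ^+ 3) ^+ 2 = D i w ^+ (2.+1).*2.
  by rewrite -exprM -[(2.+1).*2]/(2 * 3)%N mulnC !exprM real_normK ?num_real.
under [X in EFin \o X]eq_fun do rewrite -E.
under eq_Rintegral do rewrite -E.
move=> [iD ED]; split.
  split => //; apply: measurable_funX; apply: measurableT_comp => //.
  by case: (increment_sqi i).
by rewrite (le_trans ED)// !factS fact0 exprMn; nra.
Qed.

Let remainder_sqi i : square_integrable P (taylor_remainder i) /\
  second_moment P (taylor_remainder i) <= (2 * A2) ^+ 2 * (768 * dt ^+ 3).
Proof.
have [s3 e3] := cube_sqi i.
have s3' := square_integrableZ (2 * A2) s3.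
have R3 w : taylor_remainder i w ^+ 2 <= (2 * A2 * `|D i w| ^+ 3) ^+ 2.
  rewrite -[leLHS]real_normK ?num_real// ler_pXn2r ?nnegrE ?mulr_ge0 ?exprn_ge0//.
  have := second_order_taylor (B (s i) w) (D i w) dG dgP dgA2.
  by rewrite subrKC.
have sR : square_integrable P (taylor_remainder i).
  apply: square_integrable_dominated s3' => //.
  have mD : measurable_fun setT (fun w => D i w) by exact: measurable_funB.
  have mgB := measurable_fun_motion 0 (grid_ge0 i) mg.
  have mdgB := measurable_fun_motion 0 (grid_ge0 i) mdg.
  apply: measurable_funB; last by apply: measurable_funM => //; exact: measurable_funX.
  apply: measurable_funB; last by apply: measurable_funM => //; exact: measurable_funM.
  by apply: measurable_funB; apply: measurable_fun_motion => //; exact: grid_ge0.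
split => //; rewrite (le_trans (second_moment_le sR s3' R3))//.
by rewrite (second_momentZ _ s3) ler_wpM2l ?sqr_ge0.
Qed.

Let square_sqi i : square_integrable P (fun w => D i w ^+ 2 - dt) /\
  second_moment P (fun w => D i w ^+ 2 - dt) <= 64 * dt ^+ 2 /\
  \int[P]_w (D i w ^+ 2 - dt) = 0.
Proof.
have := increment_even_moment 0 1 (grid_ge0 i) (grid_le (leqnSn i)).
have := second_moment_increment 0 (grid_ge0 i) (grid_le (leqnSn i)).
have iD2 := (increment_sqi i).2.
rewrite gridS /second_moment => E2.
have E w : (D i w ^+ 2) ^+ 2 = D i w ^+ (1.+1).*2 by rewrite -exprM.
under [X in EFin \o X]eq_fun do rewrite -E.
under eq_Rintegral do rewrite -E.
move=> [iD4 ED4].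
have sD2 : square_integrable P (fun w => D i w ^+ 2).
  by split => //; apply: measurable_funX; case: (increment_sqi i).
have sc := square_integrable_cst P dt.
have ic : P.-integrable setT (EFin \o (fun=> dt)) by exact: finite_measure_integrable_cst.
have P1 : fine (P setT) = 1 by rewrite probability_setT.
split; first exact: square_integrableB.
split; last by rewrite RintegralB// Rintegral_cst// E2 P1 mulr1 subrr.
have i2 := integrableZl measurableT (- (2 * dt)) iD2.
have idt : P.-integrable setT (EFin \o (fun=> dt ^+ 2)).
  exact: finite_measure_integrable_cst.
have -> : \int[P]_w (D i w ^+ 2 - dt) ^+ 2 =
    \int[P]_w ((D i w ^+ 2) ^+ 2 + (- (2 * dt)) * D i w ^+ 2 + dt ^+ 2).
  by apply: eq_Rintegral => w _; ring.
rewrite RintegralD//; last exact: (integrableD measurableT iD4 i2).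
rewrite RintegralD// RintegralZl// E2 Rintegral_cst// P1.
by have := mesh_ge0; move: ED4; rewrite !factS fact0; nra.
Qed.

(** Up to sign the error is the sum of the Taylor remainders plus the sum of dg (D^2 - dt).
    Cauchy-Schwarz handles the former and orthogonality the latter, both at order dt. *)
Lemma ito_error_second_moment : square_integrable P ito_error /\
  second_moment P ito_error <=
  (6144 * A2 ^+ 2 * (t - a) ^+ 2 + 128 * A1 ^+ 2 * (t - a)) * dt.
Proof.
pose X i w := dg (B (s i) w) * (D i w ^+ 2 - dt).
have E w : ito_error w =
    (-1) * (\sum_(i < N) taylor_remainder i w + \sum_(i < N) X i w).
  rewrite /ito_error; have -> : G (B t w) - G (B a w) =
      \sum_(i < N) (G (B (s i.+1) w) - G (B (s i) w)).
    rewrite -(big_mkord xpredT (fun i => G (B (s i.+1) w) - G (B (s i) w))).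
    by rewrite (telescope_sumr (fun i => G (B (s i) w)))// gridN grid0.
  rewrite /ito_sum mulr_sumr -!sumrB -big_split/= mulN1r -sumrN.
  apply: eq_bigr => i _; rewrite /taylor_remainder /X; ring.
have mpsi : measurable_fun setT (fun x : R => x ^+ 2 - dt).
  by apply: measurable_funB => //; exact: measurable_funX.
have sX i : square_integrable P (X i).
  apply: (martingale_increment_sqi (psi := fun x => x ^+ 2 - dt) mdg dgA1) => j.
  by have [] := square_sqi j.
have sR i : square_integrable P (taylor_remainder i) by have [] := remainder_sqi i.
have sSR := square_integrable_sum (index_enum 'I_N) (fun i : 'I_N => sR i).
have sSX := square_integrable_sum (index_enum 'I_N) (fun i : 'I_N => sX i).
have mR : second_moment P (fun w => \sum_(i < N) taylor_remainder i w) <=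
    3072 * A2 ^+ 2 * (t - a) ^+ 2 * dt.
  rewrite (le_trans (second_moment_sum (fun i : 'I_N => sR i)))//.
  apply: (@le_trans _ _ (N%:R * \sum_(i < N) ((2 * A2) ^+ 2 * (768 * dt ^+ 3)))).
    by rewrite ler_wpM2l//; apply: ler_sum => i _; have [] := remainder_sqi i.
  rewrite sumr_const card_ord -[X in _ * X]mulr_natl.
  have := mesh_sum; move: dt => h <-.
  by rewrite le_eqVlt; apply/orP; left; apply/eqP; ring.
have mX : second_moment P (fun w => \sum_(i < N) X i w) <=
    64 * A1 ^+ 2 * (t - a) * dt.
  rewrite second_moment_orthogonal_sum//; last first.
    move=> i j ij.
    apply: (martingale_increment_orthogonal (psi := fun x => x ^+ 2 - dt) mdg dgA1) => //.
      by move=> k; have [] := square_sqi k.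
    by have [_ []] := square_sqi j.
  apply: (@le_trans _ _ (\sum_(i < N) (A1 ^+ 2 * (64 * dt ^+ 2)))).
    apply: ler_sum => i _; have [sq [sq2 _]] := square_sqi i.
    apply: (@le_trans _ _ (A1 ^+ 2 * second_moment P (fun w => D i w ^+ 2 - dt))); last first.
      by rewrite ler_wpM2l ?sqr_ge0.
    rewrite -(second_momentZ A1 sq); apply: second_moment_le => //.
      exact: square_integrableZ.
    move=> w; rewrite !exprMn ler_wpM2r ?sqr_ge0// -[leLHS]real_normK ?num_real//.
    by rewrite ler_pXn2r ?nnegrE// (le_trans (normr_ge0 (dg 0))).
  rewrite sumr_const card_ord -[leLHS]mulr_natl.
  have := mesh_sum; move: dt => h <-.
  by rewrite le_eqVlt; apply/orP; left; apply/eqP; ring.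
rewrite (_ : ito_error = fun w => (-1) *
  (\sum_(i < N) taylor_remainder i w + \sum_(i < N) X i w)); last exact/funext.
have sS := square_integrableD sSR sSX.
split; first exact: square_integrableZ.
rewrite second_momentZ// sqrrN expr1n mul1r.
rewrite (le_trans (second_momentD_le sSR sSX))//; lra.
Qed.

End DiscreteIto.
End Grid.

(** * Riemann sums of a Lipschitz function along the Brownian path *)

Definition motion_sum (f : R -> R) (a t : R) (N : nat) (w : T) : R :=
  \sum_(i < N) (t - a) / N%:R * f (B (grid a t N i) w).

Section RiemannSums.
Variables (f : R -> R) (K : R).
Hypothesis fK : forall x y, `|f y - f x| <= K * `|y - x|.

Lemma measurable_lipschitz : measurable_fun setT f.
Proof. exact: continuous_measurable_fun (lipschitz_continuous fK). Qed.

Lemma lipschitz_ge0 : 0 <= K.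
Proof. by have := fK 0 1; rewrite subr0 normr1 mulr1; exact: le_trans. Qed.

Lemma lipschitz_increment_sqi (u v : R) : 0 <= u -> u <= v ->
  square_integrable P (fun w => f (B v w) - f (B u w)) /\
  second_moment P (fun w => f (B v w) - f (B u w)) <= K ^+ 2 * (v - u).
Proof.
move=> u0 uv; have v0 := le_trans u0 uv.
have sI := square_integrable_increment 0 u0 uv.
have le w : (f (B v w) - f (B u w)) ^+ 2 <= (K * (B v w - B u w)) ^+ 2.
  rewrite -[leLHS]real_normK ?num_real// -[leRHS]real_normK ?num_real//.
  rewrite ler_pXn2r ?nnegrE// (le_trans (fK _ _))// normrM.
  by rewrite (ger0_norm lipschitz_ge0).
have sf : square_integrable P (fun w => f (B v w) - f (B u w)).
  apply: (square_integrable_dominated _ le); last exact: square_integrableZ.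
  by apply: measurable_funB; apply: measurable_fun_motion => //; exact: measurable_lipschitz.
split=> //; rewrite -(second_moment_increment 0 u0 uv) -second_momentZ//.
by apply: second_moment_le => //; exact: square_integrableZ.
Qed.

Lemma lipschitz_motion_sqi (u : R) : 0 <= u ->
  square_integrable P (fun w => f (B u w)).
Proof.
move=> u0; have [s1 _] := lipschitz_increment_sqi (lexx 0) u0.
have := square_integrableD s1 (square_integrable_cst P (f 0)).
by under eq_fun do rewrite motion0 subrK.
Qed.

(** Paths are continuous only on [0, +oo[. Composition with max(u, 0) extends them continuously to
    the line, the form in which primitives and Riemann sums are available. *)
Lemma continuous_motion_comp : {ae P, forall w,
  exists2 c : R -> R, continuous c & forall u, 0 <= u -> c u = f (B u w)}.
Proof.
apply: filterS (bm_continuous bm) => w cw.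
pose c (u : R) := f (B (Num.max u 0) w).
exists c; last first.
  by move=> u u0; rewrite /c (max_idPl u0).
move=> x; suff cB : B (Num.max u 0) w @[u --> x] --> B (Num.max x 0) w.
  have cf := lipschitz_continuous fK (x := B (Num.max x 0) w).
  by have := cvg_comp _ _ cB cf; apply.
have mx : Num.max u 0 @[u --> x] --> within `[0, +oo[ (nbhs (Num.max x 0)).
  have cmax : {for x, continuous (fun u : R => Num.max u 0)}.
    by apply: (@continuous_max _ _ id (cst 0)); [exact: cvg_id|exact: cvg_cst].
  move=> S /= /cmax; rewrite /= !near_simpl.
  by apply: filterS => u; apply; rewrite /= in_itv/= andbT le_max lexx orbT.
have x0 : `[0, +oo[%classic (Num.max x 0).
  by rewrite /= in_itv/= andbT le_max lexx orbT.
have cx := (subspace_continuousP _ _).1 cw _ x0.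
have := cvg_comp _ _ mx cx => c1.
apply: cvgB; last exact: cvg_cst.
exact: (cvg_comp _ _ c1 (@coord_continuous _ _ _ 0 0 _)).
Qed.

Variables (a t : R).
Hypotheses (a0 : 0 <= a) (at_ : a <= t).

Lemma motion_sum_sqi N : square_integrable P (motion_sum f a t N).
Proof.
apply: square_integrable_sum => i; apply: square_integrableZ.
by apply: lipschitz_motion_sqi; exact: grid_ge0.
Qed.

(** The bound does not depend on the refinement factor k, so it survives the limit k to infinity. *)
Lemma motion_sum_refine N k : (0 < N)%N -> (0 < k)%N ->
  second_moment P (fun w => motion_sum f a t N w - motion_sum f a t (N * k) w) <=
  K ^+ 2 * (t - a) ^+ 2 * ((t - a) / N%:R).
Proof.
move=> N0 k0; have Nk0 : (0 < N * k)%N by rewrite muln_gt0 N0.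
have N0' : N%:R != 0 :> R by rewrite pnatr_eq0 -lt0n.
have k0' : k%:R != 0 :> R by rewrite pnatr_eq0 -lt0n.
pose h := (t - a) / (N * k)%:R.
have h0 : 0 <= h by exact: mesh_ge0.
have hk : k%:R * h = (t - a) / N%:R by rewrite /h natrM; field; rewrite N0' k0'.
(* The fine node m lies in the coarse cell [m %/ k]; its value is compared with the one at the left
   end of that cell. *)
pose X (m : 'I_(N * k)) w :=
  - h * (f (B (grid a t (N * k) m) w) - f (B (grid a t N (m %/ k)) w)).
have gm m : grid a t (N * k) m = grid a t N (m %/ k) + (m %% k)%:R * h.
  rewrite /grid -hk -addrA -/h; congr (_ + _).
  by rewrite {1}(divn_eq m k) natrD natrM; ring.
have E w : motion_sum f a t N w - motion_sum f a t (N * k) w = \sum_m X m w.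
  have -> : motion_sum f a t N w =
      \sum_(m < N * k) h * f (B (grid a t N (m %/ k)) w).
    rewrite -(big_mkord xpredT (fun m => h * f (B (grid a t N (m %/ k)) w))).
    rewrite big_nat_mul big_mkord; apply: eq_bigr => i _.
    rewrite (eq_big_nat _ _ (F2 := fun=> h * f (B (grid a t N i) w))); last first.
      move=> m /andP[im mi]; congr (_ * f (B (grid _ _ _ _) _)).
      apply/eqP; rewrite eqn_leq -ltnS ltn_divLR// mi.
      by rewrite leq_divRL// im.
    rewrite sumr_const_nat -mulnBl subSnn mul1n -[RHS]mulr_natl -hk.
    by rewrite -mulrA.
  rewrite /motion_sum -sumrB; apply: eq_bigr => m _; rewrite /X -/h; ring.
have inc m : 0 <= grid a t N (m %/ k) /\
    grid a t N (m %/ k) <= grid a t (N * k) m.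
  by split; [exact: grid_ge0|rewrite gm lerDl mulr_ge0].
have sX m : square_integrable P (X m).
  have [i1 i2] := inc m; apply: square_integrableZ.
  exact: (lipschitz_increment_sqi i1 i2).1.
rewrite (_ : (fun w => _) = fun w => \sum_m X m w); last exact/funext.
rewrite (le_trans (second_moment_sum sX))//.
apply: (@le_trans _ _ ((N * k)%:R * \sum_(m < N * k) (h ^+ 2 * (K ^+ 2 * ((t - a) / N%:R))))).
  rewrite ler_wpM2l//; apply: ler_sum => m _.
  have [i1 i2] := inc m; have [s1 s2] := lipschitz_increment_sqi i1 i2.
  rewrite second_momentZ// sqrrN ler_wpM2l ?sqr_ge0//.
  rewrite (le_trans s2)// ler_wpM2l ?sqr_ge0//.
  rewrite gm addrAC subrr add0r -hk ler_wpM2r// ler_nat ltnW//.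
  exact: ltn_pmod.
rewrite sumr_const card_ord -[X in _ * X]mulr_natl.
have := mesh_sum a t Nk0; rewrite -/h => <-.
by rewrite le_eqVlt; apply/orP; left; apply/eqP; ring.
Qed.

Lemma motion_sum_cvg N : (0 < N)%N ->
  {ae P, forall w, motion_sum f a t (N * k.+1) w @[k --> \oo] -->
    \int[lebesgue_measure]_(u in `[a, t]) f (B u w)}.
Proof.
move=> N0; apply: filterS continuous_motion_comp => w [c cc cE].
have -> : \int[lebesgue_measure]_(u in `[a, t]) f (B u w) =
    \int[lebesgue_measure]_(u in `[a, t]) c u.
  apply: eq_Rintegral => u; rewrite inE/= in_itv/= => /andP[au _].
  by rewrite cE// (le_trans a0).
apply/cvgrPdist_le => e e0.
have [M HM] := riemann_sum_near cc at_ e0.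
near=> k; have kM : (M < N * k.+1)%N.
  by rewrite (@leq_trans k.+1)//; [near: k; exact: nbhs_infty_ge|rewrite leq_pmull].
rewrite (le_trans _ (HM _ kM))// le_eqVlt; apply/orP; left; apply/eqP; congr `|_ - _|.
by apply: eq_bigr => i _; rewrite cE//; exact: (grid_ge0 (N * k.+1) a0 at_).
Unshelve. all: by end_near. Qed.

(** Fatou's lemma along the refinements N (k + 1). The integral enters through a measurable version
    Y, which spares a proof that it is measurable in w. *)
Lemma motion_sum_second_moment (Y : T -> R) N : (0 < N)%N ->
  measurable_fun setT Y ->
  {ae P, forall w, Y w = \int[lebesgue_measure]_(u in `[a, t]) f (B u w)} ->
  square_integrable P (fun w => Y w - motion_sum f a t N w) /\
  second_moment P (fun w => Y w - motion_sum f a t N w) <=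
    K ^+ 2 * (t - a) ^+ 2 * ((t - a) / N%:R).
Proof.
move=> N0 mY aeY; apply: (@fatou_second_moment _ _ _ P
  (fun k w => (-1) * (motion_sum f a t N w - motion_sum f a t (N * k.+1) w))).
- move=> k; apply: square_integrableZ.
  by apply: square_integrableB; exact: motion_sum_sqi.
- move=> k; rewrite second_momentZ; last first.
    by apply: square_integrableB; exact: motion_sum_sqi.
  by rewrite sqrrN expr1n mul1r motion_sum_refine.
- by apply: measurable_funB => //; case: (motion_sum_sqi N).
- apply: filterS2 (motion_sum_cvg N0) aeY => w cw ->.
  under eq_fun do rewrite mulN1r opprB.
  by apply: cvgB => //; exact: cvg_cst.
Qed.

End RiemannSums.
End BrownianMotion.

(** * Displacement in a shear flow *)

Section ShearDisplacement.
Context (R : realType) d (T : measurableType d) (P : probability T R).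
Variables (omega : R -> T -> 'rV[R]_2) (Y : R -> T -> R) (f : R -> R) (L : R).
Hypothesis bm : brownian_motion P omega.
Hypothesis fL : forall x y, `|f y - f x| <= L * `|y - x|.

Local Notation B := (motion omega 0).
Local Notation W := (motion omega 1).

Hypothesis mY : forall t, 0 <= t -> measurable_fun setT (Y t).
Hypothesis Y_eq : {ae P, forall w, forall t, 0 <= t ->
  Y t w = W t w + \int[lebesgue_measure]_(u in `[0, t]) f (B u w)}.

(** Almost surely the integral of f(B) over [a, t], written through the processes so that it
    inherits their measurability. *)
Let drift (a t : R) (w : T) : R := (Y t w - W t w) - (Y a w - W a w).

Let measurable_drift (a t : R) : 0 <= a -> a <= t ->
  measurable_fun setT (drift a t).
Proof.
move=> a0 at_; have t0 := le_trans a0 at_.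
by apply: measurable_funB; apply: measurable_funB;
  [exact: mY|exact: (measurable_motion bm)|exact: mY|exact: (measurable_motion bm)].
Qed.

Let drift_eq (a t : R) : 0 <= a -> a <= t ->
  {ae P, forall w, drift a t w =
    \int[lebesgue_measure]_(u in `[a, t]) f (B u w)}.
Proof.
move=> a0 at_; have t0 := le_trans a0 at_.
apply: filterS2 (continuous_motion_comp bm fL) Y_eq => w [c cc cE] Yw.
have cI u v : 0 <= u -> \int[lebesgue_measure]_(x in `[u, v]) f (B x w) =
    \int[lebesgue_measure]_(x in `[u, v]) c x.
  move=> u0; apply: eq_Rintegral => x; rewrite inE/= in_itv/= => /andP[ux _].
  by rewrite cE// (le_trans u0).
have [A dA] := primitive_exists cc.
rewrite /drift !Yw// !cI// !(Rintegral_primitive cc dA)//; ring.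
Qed.

Let drift_riemann (a t : R) N : 0 <= a -> a <= t -> (0 < N)%N ->
  square_integrable P (fun w => drift a t w - motion_sum omega f a t N w) /\
  second_moment P (fun w => drift a t w - motion_sum omega f a t N w) <=
    L ^+ 2 * (t - a) ^+ 2 * ((t - a) / N%:R).
Proof.
move=> a0 at_ N0; apply: (motion_sum_second_moment bm fL) => //.
- exact: measurable_drift.
- exact: drift_eq.
Qed.

Let drift0_riemann (t : R) N : 0 <= t -> (0 < N)%N ->
  square_integrable P (fun w => Y t w - W t w - motion_sum omega f 0 t N w) /\
  second_moment P (fun w => Y t w - W t w - motion_sum omega f 0 t N w) <=
    L ^+ 2 * t ^+ 2 * (t / N%:R).
Proof.
move=> t0 N0.
have mX : measurable_fun setT (fun w => Y t w - W t w).
  by apply: measurable_funB; [exact: mY|exact: (measurable_motion bm)].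
have aeX : {ae P, forall w, Y t w - W t w =
    \int[lebesgue_measure]_(u in `[0, t]) f (B u w)}.
  by apply: filterS Y_eq => w ->//; rewrite addrC addKr.
by have := motion_sum_second_moment bm fL (lexx 0) t0 N0 mX aeX; rewrite subr0.
Qed.

(* The decomposition f = dg + r into rapidly oscillating and slowly varying
   parts, with G'' / 2 = dg. *)
Variables (G g dg r : R -> R) (A0 A1 A2 e : R).
Hypotheses (dG : forall z : R, is_derive z 1 G (2 * g z))
  (dgP : forall z : R, is_derive z 1 g (dg z))
  (gA0 : forall z, `|g z| <= A0)
  (dgA1 : forall z, `|dg z| <= A1)
  (dgA2 : forall y z, `|dg z - dg y| <= A2 * `|z - y|)
  (re : forall y z, `|r z - r y| <= e * `|z - y|)
  (fE : forall z, f z = dg z + r z).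

Let mg : measurable_fun setT g.
Proof.
apply: continuous_measurable_fun => x; exact: is_derive_continuous (dgP x).
Qed.

Let motion_sum_split a t N w : motion_sum omega f a t N w =
  ito_error omega a t N G g dg w + (G (B t w) - G (B a w)) -
  2 * ito_sum omega a t N g w + motion_sum omega r a t N w.
Proof.
rewrite /ito_error /motion_sum.
under eq_bigr do rewrite fE mulrDr.
rewrite big_split/=; ring.
Qed.

Let slow_part (a t : R) N : 0 <= a -> a <= t -> (0 < N)%N ->
  square_integrable P (fun w => motion_sum omega r a t N w - (t - a) * r (B a w)) /\
  second_moment P (fun w => motion_sum omega r a t N w - (t - a) * r (B a w)) <=
    e ^+ 2 * (t - a) ^+ 3.
Proof.
move=> a0 at_ N0; set h := (t - a) / N%:R.
pose X (i : 'I_N) w := h * (r (B (grid a t N i) w) - r (B a w)).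
have gi (i : 'I_N) : a <= grid a t N i /\ grid a t N i <= t.
  split; first exact: grid_gea.
  by have := grid_le N at_ (ltnW (ltn_ord i)); rewrite gridN.
have sX i : square_integrable P (X i).
  by have [i1 i2] := gi i; apply/square_integrableZ/(lipschitz_increment_sqi bm re a0 i1).1.
have E w : motion_sum omega r a t N w - (t - a) * r (B a w) = \sum_i X i w.
  have := mesh_sum a t N0; rewrite /motion_sum -/h /X => <-.
  under [RHS]eq_bigr do rewrite mulrBr.
  by rewrite sumrB sumr_const card_ord -[X in _ = _ - X]mulr_natl -mulrA.
rewrite (_ : (fun w => _) = fun w => \sum_i X i w); last exact/funext.
split; first exact: square_integrable_sum.
rewrite (le_trans (second_moment_sum sX))//.
apply: (@le_trans _ _ (N%:R * \sum_(i < N) (h ^+ 2 * (e ^+ 2 * (t - a))))).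
  rewrite ler_wpM2l//; apply: ler_sum => i _; have [i1 i2] := gi i.
  have [s1 s2] := lipschitz_increment_sqi bm re a0 i1.
  rewrite second_momentZ// ler_wpM2l ?sqr_ge0// (le_trans s2)//.
  by rewrite ler_wpM2l ?sqr_ge0// lerB.
rewrite sumr_const card_ord -[X in _ * X]mulr_natl.
have := mesh_sum a t N0; rewrite -/h => <-.
by rewrite le_eqVlt; apply/orP; left; apply/eqP; ring.
Qed.

Let primitive_lipschitz x y : `|G y - G x| <= 2 * A0 * `|y - x|.
Proof.
apply: lipschitz_of_derive dG _ => z.
by rewrite normrM normr_nat ler_wpM2l.
Qed.

(** The boundary term of [G] and the Ito sum are both of order A0^2 t. The constants [A1] and [A2]
    occur only in C, which disappears as N grows. *)
Lemma motion_sum_second_moment_le (t : R) : r 0 = 0 -> 0 <= t ->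
  exists C, forall N, (0 < N)%N ->
  second_moment P (motion_sum omega f 0 t N) <=
    64 * A0 ^+ 2 * t + 4 * e ^+ 2 * t ^+ 3 + C / N%:R.
Proof.
move=> r0 t0.
exists (2 * (6144 * A2 ^+ 2 * t ^+ 2 + 128 * A1 ^+ 2 * t) * t) => N N0.
have [serr merr] := ito_error_second_moment bm (lexx 0) t0 N0 dG dgP dgA1 dgA2.
have sI := ito_sum_sqi bm N (lexx 0) t0 mg gA0.
have mI := ito_sum_second_moment_le bm (lexx 0) t0 N0 mg gA0.
have [sG mG] := lipschitz_increment_sqi bm primitive_lipschitz (lexx 0) t0.
have [sr mr] := slow_part (lexx 0) t0 N0.
rewrite !subr0 in merr mI mG sr mr.
have sI2 := square_integrableZ 2 sI.
have sGI := square_integrableB sG sI2.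
have sGIr := square_integrableD sGI sr.
rewrite (_ : motion_sum omega f 0 t N = fun w => ito_error omega 0 t N G g dg w +
    ((G (B t w) - G (B 0 w) - 2 * ito_sum omega 0 t N g w) +
     (motion_sum omega r 0 t N w - t * r (B 0 w)))); last first.
  by apply/funext => w; rewrite motion_sum_split motion0 r0; ring.
have m1 := second_momentD_le serr sGIr.
have m2 := second_momentD_le sGI sr.
have m3 := second_momentB_le sG sI2.
rewrite second_momentZ// in m3.
have -> : 2 * (6144 * A2 ^+ 2 * t ^+ 2 + 128 * A1 ^+ 2 * t) * t / N%:R =
   2 * ((6144 * A2 ^+ 2 * t ^+ 2 + 128 * A1 ^+ 2 * t) * (t / N%:R)) by ring.
by nra.
Qed.

Lemma displacement_upper_bound (t : R) : r 0 = 0 -> 0 <= t ->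
  square_integrable P (Y t) /\
  second_moment P (Y t) <= 2 * t + 256 * A0 ^+ 2 * t + 16 * e ^+ 2 * t ^+ 3.
Proof.
move=> r0 t0; have [C HC] := motion_sum_second_moment_le r0 t0.
have sW := square_integrable_motion bm 1 t0.
have E N : Y t = fun w => W t w + (motion_sum omega f 0 t N w +
    (Y t w - W t w - motion_sum omega f 0 t N w)).
  by apply/funext => w; ring.
have bound N : (0 < N)%N -> square_integrable P (Y t) /\
    second_moment P (Y t) <= 2 * t + 256 * A0 ^+ 2 * t + 16 * e ^+ 2 * t ^+ 3 +
      (4 * C + 4 * (L ^+ 2 * t ^+ 3)) / N%:R.
  move=> N0; have [sd md] := drift0_riemann t0 N0.
  have sS := motion_sum_sqi bm fL (lexx 0) t0 N.
  have sSd := square_integrableD sS sd.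
  have m1 := second_momentD_le sW sSd.
  have m2 := second_momentD_le sS sd.
  have mS := HC _ N0.
  have mW := second_moment_motion bm 1 t0.
  rewrite (E N); split; first exact: square_integrableD.
  have -> : (4 * C + 4 * (L ^+ 2 * t ^+ 3)) / N%:R =
     4 * (C / N%:R) + 4 * (L ^+ 2 * t ^+ 2 * (t / N%:R)) by ring.
  lra.
split; first by case: (bound 1%N isT).
apply: (ler_of_div (C := 4 * C + 4 * (L ^+ 2 * t ^+ 3))) => N N0.
by case: (bound N N0).
Qed.

(** * Lower bound by testing against the martingale of one scale *)

Section LowerBound.
Variables (g0 phi : R -> R) (Gam Kg Kphi KG c0 a t : R).
Hypotheses (mg0 : measurable_fun setT g0) (mphi : measurable_fun setT phi)
  (g0K : forall z, `|g0 z| <= Kg) (phiK : forall z, `|phi z| <= Kphi)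
  (gE : forall z, g z = g0 z + Gam * phi z)
  (GK : forall x y, `|G y - G x| <= KG + 2 * Kg * `|y - x|)
  (a0 : 0 <= a) (at_ : a <= t)
  (phi_c0 : forall s, a <= s -> c0 <= \int[P]_w (phi (B s w) ^+ 2)).

Let t0 : 0 <= t := le_trans a0 at_.

Section Mesh.
Variables (N : nat).
Hypothesis N0 : (0 < N)%N.

Local Notation Z := (ito_sum omega a t N phi).

Let sZ : square_integrable P Z.
Proof. exact: (ito_sum_sqi bm N a0 at_ mphi phiK). Qed.

Let term_sqi (i : nat) : square_integrable P (fun w => phi (B (grid a t N i) w) *
  (B (grid a t N i.+1) w - B (grid a t N i) w)).
Proof.
exact: (martingale_increment_sqi bm a0 at_ (psi := idfun) mphi phiK
  (increment_sqi bm N a0 at_)).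
Qed.

Let increment_mean0 (i : nat) :
  \int[P]_w idfun (B (grid a t N i.+1) w - B (grid a t N i) w) = 0.
Proof.
by have := increment_mean bm 0 (grid_ge0 N a0 at_ i) (grid_le N at_ (leqnSn i)).
Qed.

Let orthogonal_sum (X : T -> R) : square_integrable P X ->
  (forall i : 'I_N, \int[P]_w (X w * (phi (B (grid a t N i) w) *
     (B (grid a t N i.+1) w - B (grid a t N i) w))) = 0) ->
  \int[P]_w (X w * Z w) = 0.
Proof.
move=> sX X0; rewrite /ito_sum; under eq_Rintegral do rewrite mulr_sumr.
rewrite Rintegral_sum; first by rewrite big1.
by move=> i; exact: (integrable_prod sX (term_sqi i)).
Qed.

Let orthogonal_W : \int[P]_w (W t w * Z w) = 0.
Proof.
apply: orthogonal_sum; first exact: square_integrable_motion.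
move=> i; apply: (martingale_increment_second_coordinate bm a0 at_ (psi := idfun)
  mphi phiK (@measurable_id _ _ _) (increment_sqi bm N a0 at_)) => //.
by have := grid_le N at_ (ltn_ord i); rewrite gridN.
Qed.

Let orthogonal_past (q : R -> R) (l u : R) :
  (forall y z, `|q z - q y| <= l * `|z - y|) -> 0 <= u -> u <= a ->
  \int[P]_w (q (B u w) * Z w) = 0.
Proof.
move=> ql u0 ua; have sq := lipschitz_motion_sqi bm ql u0.
apply: orthogonal_sum => // i.
apply: (martingale_increment_past_orthogonal bm a0 at_ (psi := idfun) mphi phiK
  (@measurable_id _ _ _) (increment_sqi bm N a0 at_)) => //.
- by rewrite (le_trans ua)// grid_gea.
- exact: measurable_lipschitz ql.
Qed.

(** The past drift is represented by its Riemann sum, so that orthogonality reduces to single times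
    u <= a; the error goes into [Rm]. *)
Let orthogonal_motion_sum :
  \int[P]_w (motion_sum omega f 0 a N w * Z w) = 0.
Proof.
rewrite /motion_sum; under eq_Rintegral do rewrite mulr_suml.
have gi (i : 'I_N) : 0 <= grid 0 a N i /\ grid 0 a N i <= a.
  split; first exact: grid_ge0.
  by have := grid_le N a0 (ltnW (ltn_ord i)); rewrite gridN.
rewrite Rintegral_sum.
  rewrite big1// => i _; have [i1 i2] := gi i.
  under eq_Rintegral do rewrite -mulrA.
  rewrite RintegralZl// ?(orthogonal_past fL)// ?mulr0//.
  exact: (integrable_prod (lipschitz_motion_sqi bm fL i1) sZ).
move=> i; have [i1 i2] := gi i.
apply: (integrable_prod _ sZ); apply: square_integrableZ.
exact: (lipschitz_motion_sqi bm fL i1).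
Qed.

(* The displacement before time a and the second coordinate of the noise, all
   orthogonal to Z, to which the linear part of the slow drift is added. *)
Let O w := W t w + (motion_sum omega f 0 a N w + (t - a) * r (B a w)).

Let sO : square_integrable P O.
Proof.
apply: square_integrableD; first exact: square_integrable_motion.
apply: square_integrableD; first exact: (motion_sum_sqi bm fL (lexx 0) a0 N).
apply: square_integrableZ; exact: (lipschitz_motion_sqi bm re a0).
Qed.

Let orthogonal_O : \int[P]_w (O w * Z w) = 0.
Proof.
have sW := square_integrable_motion bm 1 t0.
have sS := motion_sum_sqi bm fL (lexx 0) a0 N.
have sr := lipschitz_motion_sqi bm re a0.
have -> : \int[P]_w (O w * Z w) = \int[P]_w (W t w * Z w +
    (motion_sum omega f 0 a N w * Z w + (t - a) * (r (B a w) * Z w))).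
  by apply: eq_Rintegral => w _; rewrite /O; ring.
have i1 := integrable_prod sW sZ.
have i2 := integrable_prod sS sZ.
have i3 := integrable_prod sr sZ.
have i3' := integrableZl measurableT (t - a) i3.
have i23 := integrableD measurableT i2 i3'.
rewrite RintegralD// RintegralD// RintegralZl//.
by rewrite orthogonal_W orthogonal_motion_sum (orthogonal_past re)// mulr0 !addr0.
Qed.

(** The two Riemann errors and the Ito error vanish as N grows. The fluctuation of the slow part,
    the boundary term and the Ito sum of the lower scales [g0] persist and have to be beaten by the
    choice of the constants. *)
Let Rm w := (Y a w - W a w - motion_sum omega f 0 a N w +
    (drift a t w - motion_sum omega f a t N w + ito_error omega a t N G g dg w)) +
  ((motion_sum omega r a t N w - (t - a) * r (B a w)) +
   (G (B t w) - G (B a w) - 2 * ito_sum omega a t N g0 w)).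

Let Y_decomposition w : 2 * Gam * Z w = O w + (Rm w - Y t w).
Proof.
have : ito_sum omega a t N g w = ito_sum omega a t N g0 w + Gam * Z w.
  rewrite /ito_sum mulr_sumr -big_split/=; apply: eq_bigr => i _.
  by rewrite gE; ring.
by rewrite /Rm /O /drift (motion_sum_split a t N w) => ->; ring.
Qed.

Let Rm_bound : square_integrable P Rm /\ second_moment P Rm <=
  4 * e ^+ 2 * (t - a) ^+ 3 + 16 * KG ^+ 2 + 96 * Kg ^+ 2 * (t - a) +
  (4 * (L ^+ 2 * a ^+ 3) + 8 * (L ^+ 2 * (t - a) ^+ 3) +
   8 * ((6144 * A2 ^+ 2 * (t - a) ^+ 2 + 128 * A1 ^+ 2 * (t - a)) * (t - a))) / N%:R.
Proof.
have [s1 m1] := drift0_riemann a0 N0.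
have [s2 m2] := drift_riemann a0 at_ N0.
have [s3 m3] := ito_error_second_moment bm a0 at_ N0 dG dgP dgA1 dgA2.
have [s4 m4] := slow_part a0 at_ N0.
have [s5 m5] : square_integrable P (fun w => G (B t w) - G (B a w)) /\
    second_moment P (fun w => G (B t w) - G (B a w)) <=
    2 * KG ^+ 2 + 8 * Kg ^+ 2 * (t - a).
  (* Only square integrability is taken from the Lipschitz constant 2 A0, which includes the current
     scale. The size comes from [GK], where that scale enters through the bounded part KG. *)
  have [s _] := lipschitz_increment_sqi bm primitive_lipschitz a0 at_.
  have sB := square_integrable_increment bm 0 a0 at_.
  split => //.
  have sb := square_integrableZ (2 * Kg) sB.
  have Kg0 : 0 <= Kg := le_trans (normr_ge0 _) (g0K 0).
  pose V w := `|KG| + 2 * Kg * `|B t w - B a w|.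
  have sabs : square_integrable P (fun w => 2 * Kg * `|B t w - B a w|).
    apply: square_integrable_dominated sb.
      by apply: measurable_funM => //; apply: measurableT_comp => //; case: sB.
    by move=> w; rewrite !exprMn real_normK ?num_real.
  have sK := square_integrable_cst P `|KG|.
  have sV := square_integrableD sK sabs.
  apply: (@le_trans _ _ (second_moment P V)).
    apply: second_moment_le => // w.
    have V0 : 0 <= V w by rewrite /V addr_ge0// !mulr_ge0.
    rewrite -[leLHS]real_normK ?num_real// ler_pXn2r ?nnegrE//.
    by rewrite (le_trans (GK _ _))// lerD2r ler_norm.
  rewrite (le_trans (second_momentD_le sK sabs))//.
  have -> : second_moment P (fun w => 2 * Kg * `|B t w - B a w|) =
      second_moment P (fun w => 2 * Kg * (B t w - B a w)).
    by apply: eq_Rintegral => w _; rewrite !exprMn real_normK ?num_real.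
  rewrite second_momentZ// second_moment_increment//.
  have -> : second_moment P (fun=> `|KG|) = KG ^+ 2.
    have P1 : fine (P setT) = 1 by rewrite probability_setT.
    by rewrite /second_moment Rintegral_cst// P1 mulr1 real_normK ?num_real.
  by rewrite exprMn; nra.
have s6 := ito_sum_sqi bm N a0 at_ mg0 g0K.
have m6 := ito_sum_second_moment_le bm a0 at_ N0 mg0 g0K.
have s6' := square_integrableZ 2 s6.
have s56 := square_integrableB s5 s6'.
have m56 := second_momentB_le s5 s6'; rewrite second_momentZ// in m56.
have s456 := square_integrableD s4 s56.
have m456 := second_momentD_le s4 s56.
have s23 := square_integrableD s2 s3.
have m23 := second_momentD_le s2 s3.
have s123 := square_integrableD s1 s23.
have m123 := second_momentD_le s1 s23.
split; first exact: square_integrableD.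
rewrite (le_trans (second_momentD_le s123 s456))//.
set E1 := L ^+ 2 * (t - a) ^+ 2 * ((t - a) / N%:R) in m2.
set E2 := L ^+ 2 * a ^+ 2 * (a / N%:R) in m1.
set E3 := (_ + _) * ((t - a) / N%:R) in m3.
have -> : (4 * (L ^+ 2 * a ^+ 3) + 8 * (L ^+ 2 * (t - a) ^+ 3) +
   8 * ((6144 * A2 ^+ 2 * (t - a) ^+ 2 + 128 * A1 ^+ 2 * (t - a)) * (t - a))) / N%:R
   = 4 * E2 + 8 * E1 + 8 * E3 by rewrite /E1 /E2 /E3; ring.
lra.
Qed.

(** With v = Rm - Y_t = 2 Gam Z - O, pointwise 2 Gam^2 Z^2 + O^2 / 2 = 2 Gam Z O + v^2 / 2. The
    square of O is dropped, and the cross term has integral 0. *)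
Let mesh_lower_bound : square_integrable P (Y t) ->
  2 * Gam ^+ 2 * (c0 * (t - a)) <= second_moment P (Y t) + second_moment P Rm.
Proof.
move=> sY; have [sR _] := Rm_bound.
have sRY := square_integrableB sR sY.
have mRY := second_momentB_le sR sY.
have mZ : c0 * (t - a) <= second_moment P Z.
  rewrite (ito_isometry bm N a0 at_ mphi phiK).
  apply: (@le_trans _ _ (\sum_(i < N) (t - a) / N%:R * c0)).
    rewrite sumr_const card_ord -[leRHS]mulr_natl mulrA (mesh_sum a t N0).
    by rewrite mulrC.
  apply: ler_sum => i _; rewrite ler_wpM2l ?mesh_ge0//.
  by apply: phi_c0; exact: grid_gea.
have le : 2 * Gam ^+ 2 * second_moment P Z <=
    2 * Gam * \int[P]_w (O w * Z w) +
    2^-1 * second_moment P (fun w => Rm w - Y t w).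
  have iOZ := integrable_prod sO sZ.
  have iOZ' := integrableZl measurableT (2 * Gam) iOZ.
  have iRY := integrableZl measurableT (2^-1) sRY.2.
  rewrite /second_moment -!RintegralZl//; [|exact: sRY.2|exact: sZ.2].
  rewrite -RintegralD//; apply: le_Rintegral => //.
  - exact: (integrableZl measurableT (2 * Gam ^+ 2) sZ.2).
  - exact: (integrableD measurableT iOZ' iRY).
  - move=> w _ /=; have := Y_decomposition w.
    set z := Z w; set o := O w; set v := Rm w - Y t w => E.
    have : v = 2 * Gam * z - o by rewrite E; ring.
    move=> ->; nra.
rewrite orthogonal_O mulr0 add0r in le.
have Gam2 := sqr_ge0 Gam.
apply: (@le_trans _ _ (2 * Gam ^+ 2 * second_moment P Z)).
  by rewrite ler_wpM2l// mulr_ge0.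
lra.
Qed.

Lemma mesh_displacement_lower_bound : square_integrable P (Y t) ->
  2 * Gam ^+ 2 * (c0 * (t - a)) - (4 * e ^+ 2 * (t - a) ^+ 3 + 16 * KG ^+ 2 +
    96 * Kg ^+ 2 * (t - a)) <= second_moment P (Y t) +
  (4 * (L ^+ 2 * a ^+ 3) + 8 * (L ^+ 2 * (t - a) ^+ 3) +
   8 * ((6144 * A2 ^+ 2 * (t - a) ^+ 2 + 128 * A1 ^+ 2 * (t - a)) * (t - a))) / N%:R.
Proof.
by move=> sY; have [_] := Rm_bound; have := mesh_lower_bound sY; lra.
Qed.

End Mesh.

Lemma displacement_lower_bound : square_integrable P (Y t) ->
  2 * Gam ^+ 2 * (c0 * (t - a)) - (4 * e ^+ 2 * (t - a) ^+ 3 + 16 * KG ^+ 2 +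
    96 * Kg ^+ 2 * (t - a)) <= second_moment P (Y t).
Proof.
move=> sY; apply: ler_of_div => N N0; exact: mesh_displacement_lower_bound.
Qed.

End LowerBound.

End ShearDisplacement.

(** * Series dominated by a geometric series *)

Section DominatedSeries.
Variable R : realType.
Implicit Types a b : nat -> R.

Lemma geometric_dominated_cvg a (K q : R) : 0 < q < 1 ->
  (forall k, `|a k| <= K * q ^+ k) -> cvgn (series a).
Proof.
move=> /andP[q0 q1] aK; apply: normed_cvg.
apply: (@series_le_cvg _ _ (geometric K q)) => //.
- by move=> k /=.
- by move=> k; exact: le_trans (normr_ge0 _) (aK k).
- by apply: is_cvg_geometric_series; rewrite gtr0_norm.
Qed.

Lemma geometric_dominated_tail a (K q : R) (n : nat) : 0 < q < 1 ->
  (forall k, `|a k| <= K * q ^+ k) ->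
  `|limn (series a) - \sum_(k < n) a k| <= K * q ^+ n / (1 - q).
Proof.
move=> q01 aK; have ca := geometric_dominated_cvg q01 aK.
move/andP: q01 => [q0 q1].
have K0 : 0 <= K by have := aK 0%N; rewrite expr0 mulr1; exact: le_trans.
have bnd m : `|series a (n + m)%N - \sum_(k < n) a k| <= K * q ^+ n / (1 - q).
  rewrite /series/= (big_cat_nat (leq0n n) (leq_addr m n))/=.
  rewrite big_mkord addrAC subrr add0r (le_trans (ler_norm_sum _ _ _))//.
  apply: (@le_trans _ _ (\sum_(n <= k < n + m) (K * q ^+ k))).
    by apply: ler_sum => k _.
  rewrite -mulr_sumr geometric_partial_tail -mulrA ler_wpM2l//.
  by apply: geometric_le_lim; rewrite ?exprn_ge0 ?gtr0_norm ?ltW.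
apply/ler_addgt0Pr => e e0.
have /cvgrPdist_le /(_ e e0) [m _ Hm] := ca.
have := bnd m; have := Hm (n + m)%N (leq_addl _ _).
have := ler_distD (series a (n + m)%N) (limn (series a)) (\sum_(k < n) a k).
lra.
Qed.

(** Reduces the differentiation of a series to a summable quadratic bound on the Taylor remainders
    of its terms. *)
Lemma is_derive_quadratic (F : R -> R) (l x C : R) :
  (forall v, `|F (x + v) - F x - v * l| <= C * v ^+ 2) -> is_derive x 1 F l.
Proof.
move=> FC.
have C0 : 0 <= C by have := FC 1; rewrite expr1n mulr1; exact: le_trans.
have H : v^-1 *: (F (v *: 1 + x) - F x) @[v --> 0^'] --> l.
  apply/cvgrPdist_le => e e0.
  have C1 : 0 < C + 1 by rewrite ltr_wpDl.
  near=> v; have v0 : v != 0 by near: v; exact: nbhs_dnbhs_neq.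
  have -> : l - v^-1 *: (F (v *: 1 + x) - F x) =
      - (v^-1 * (F (x + v) - F x - v * l)).
    by rewrite /GRing.scale/= mulr1 (addrC v); field.
  rewrite normrN normrM normfV ler_pdivrMl ?normr_gt0//.
  rewrite (le_trans (FC v))// -[v ^+ 2]real_normK ?num_real// expr2.
  rewrite mulrCA mulrA mulrC ler_wpM2l//.
  have ve : `|v| <= e / (C + 1).
    near: v; apply: dnbhs0_le; rewrite divr_gt0//.
  rewrite mulrC -[leRHS](divfK (lt0r_neq0 C1)) mulrC.
  by rewrite ler_pM// lerDl.
split; first by apply/cvg_ex; exists l.
exact: cvg_lim H.
Unshelve. all: by end_near. Qed.

(** * Termwise differentiation under summable Lipschitz constants of the derivatives *)

Section Termwise.
Variables (u du : nat -> R -> R) (K q : R).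
Hypotheses (q01 : 0 < q < 1)
  (dU : forall k (x : R), is_derive x 1 (u k) (du k x))
  (duK : forall k x y, `|du k y - du k x| <= K * q ^+ k * `|y - x|)
  (u0 : forall k, u k 0 = 0) (du0 : forall k, du k 0 = 0).

(** The terms vanish to first order at 0, so the Lipschitz constants alone give convergence at every
    x, even when the sup norms of u_k and u_k' grow with k. *)
Let du_le k x : `|du k x| <= K * `|x| * q ^+ k.
Proof. by have := duK k 0 x; rewrite du0 !subr0 mulrAC. Qed.

Let taylor k x v : `|u k (x + v) - u k x - v * du k x| <= K * v ^+ 2 * q ^+ k.
Proof.
have [z zv] := mean_value x (x + v) (dU k); rewrite addrAC subrr add0r in zv *.
move=> ->; rewrite (mulrC v) -mulrBl normrM.
rewrite -[v ^+ 2]real_normK ?num_real// expr2 mulrAC mulrA ler_wpM2r//.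
rewrite (le_trans (duK k x z))// ler_wpM2l//.
by have := duK k 0 1; rewrite subr0 normr1 mulr1; exact: le_trans.
Qed.

Lemma termwise_lipschitz_tail (n : nat) (x y : R) :
  `|(limn (series (du^~ y)) - \sum_(k < n) du k y) -
    (limn (series (du^~ x)) - \sum_(k < n) du k x)| <=
  K * q ^+ n / (1 - q) * `|y - x|.
Proof.
have cy := geometric_dominated_cvg q01 (du_le^~ y).
have cx := geometric_dominated_cvg q01 (du_le^~ x).
have aK k : `|du k y - du k x| <= K * `|y - x| * q ^+ k.
  by rewrite mulrAC.
have := geometric_dominated_tail n q01 aK.
have -> : limn (series (fun k => du k y - du k x)) =
    limn (series (du^~ y)) - limn (series (du^~ x)).
  exact: (lim_seriesB cy cx).
rewrite sumrB => H; rewrite (_ : _ - _ - _ = limn (series (du^~ y)) -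
    limn (series (du^~ x)) - (\sum_(i < n) du i y - \sum_(i < n) du i x)); last by ring.
by rewrite (le_trans H)// le_eqVlt; apply/orP; left; apply/eqP; ring.
Qed.

Lemma termwise_derive (x : R) :
  is_derive x 1 (fun y => limn (series (u^~ y))) (limn (series (du^~ x))).
Proof.
have u_le k y : `|u k y| <= K * y ^+ 2 * q ^+ k.
  by have := taylor k 0 y; rewrite add0r u0 du0 mulr0 !subr0.
apply: (@is_derive_quadratic _ _ _ (K / (1 - q))) => v.
have c1 := geometric_dominated_cvg q01 (u_le^~ (x + v)).
have c2 := geometric_dominated_cvg q01 (u_le^~ x).
have c3 := geometric_dominated_cvg q01 (du_le^~ x).
have := geometric_dominated_tail 0 q01 (fun k => taylor k x v).
have -> : limn (series (fun k => u k (x + v) - u k x - v * du k x)) =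
    limn (series (u^~ (x + v))) - limn (series (u^~ x)) - v * limn (series (du^~ x)).
  have c3v : limn (series (v *: (du^~ x))) = v * limn (series (du^~ x)) .
    exact: lim_seriesZ.
  have c3v' : cvgn (series (v *: (du^~ x))) by exact: is_cvg_seriesZ.
  have c12 := is_cvg_seriesB c1 c2.
  by rewrite -c3v -(lim_seriesB c1 c2) -(lim_seriesB c12 c3v').
rewrite big_ord0 subr0 expr0 mulr1 => H.
by rewrite (le_trans H)// le_eqVlt; apply/orP; left; apply/eqP; ring.
Qed.

End Termwise.
End DominatedSeries.

(** * Periodic functions *)

Section Periodic.
Variable R : realType.
Implicit Types (c A k H : R -> R).

(** A(z + 1) - A(z) has derivative 0, hence equals its value at z = 0, the mean. *)
Lemma primitive_periodic c A (n : nat) (x : R) : continuous c ->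
  (forall x, c (x + 1) = c x) -> (forall x : R, is_derive x 1 A (c x)) ->
  A (x + n%:R) - A x = n%:R * unit_mean c.
Proof.
move=> cc c1 dA.
have step z : A (z + 1) - A z = unit_mean c.
  pose E (v : R) := A (v + 1) - A v.
  have dE (v : R) : is_derive v 1 E 0.
    have dA1 : is_derive (shift 1 v) 1 A (c v) by rewrite /shift/= -c1.
    have ds : is_derive v 1 (shift 1) 1 := is_derive_shift _ _ _.
    rewrite (_ : E = (A \o shift 1) - A)//.
    by apply: is_derive_eq; rewrite /GRing.scale/= mulr1 subrr.
  have := mean_value (c := fun=> 0) 0 z dE => -[v _].
  rewrite mul0r => /eqP; rewrite subr_eq0 => /eqP; rewrite /E add0r => ->.
  by rewrite /unit_mean (Rintegral_primitive cc dA).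
elim: n => [|n ih]; first by rewrite addr0 subrr mul0r.
by rewrite -natr1 addrA mulrDl mul1r; have := step (x + n%:R); lra.
Qed.

(** By the mean value theorem for a primitive, the mean is itself a value of [c]. *)
Lemma unit_mean_near c (K x : R) : continuous c ->
  (forall x y, `|c x - c y| <= K) -> `|c x - unit_mean c| <= K.
Proof.
move=> cc cK; have [A dA] := primitive_exists cc.
rewrite /unit_mean (Rintegral_primitive cc dA)//.
by have [z _ ->] := mean_value 0 1 dA; rewrite subr0 mulr1.
Qed.

(** Mean zero makes the primitive periodic, so y may be moved to within one period of x. *)
Lemma primitive_zero_mean_bounded k H (K x y : R) : continuous k ->
  (forall x, k (x + 1) = k x) -> (forall x : R, is_derive x 1 H (k x)) ->
  unit_mean k = 0 -> (forall x, `|k x| <= K) -> `|H y - H x| <= K.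
Proof.
move=> ck k1 dH k0 kK; wlog xy : x y / x <= y.
  move=> wl; have [xy|/ltW yx] := leP x y; first exact: wl.
  by rewrite distrC; exact: wl.
have yx0 : 0 <= y - x by rewrite subr_ge0.
pose n := Num.truncn (y - x); pose z := y - n%:R.
have /andP[nyx yxn] : n%:R <= y - x < n.+1%:R by exact: truncn_itv.
have Hz : H y = H z.
  have := primitive_periodic n z ck k1 dH.
  by rewrite k0 mulr0 /z subrK => /eqP; rewrite subr_eq0 => /eqP.
rewrite Hz (le_trans (lipschitz_of_derive x z dH kK))//.
rewrite ler_piMr//; first exact: le_trans (normr_ge0 _) (kK 0).
rewrite /z ger0_norm; last by lra.
by move: yxn; rewrite -natr1; lra.
Qed.

(* On [0, sqrt s] the Gaussian density of variance s is at least
   exp (- 1 / 2) / sqrt (2 pi s), and this interval contains a number of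
   periods that is at least sqrt s / (2 l). *)
Definition gauss_floor : R := normal_peak 1 * expR (- 2^-1) / 2.

Lemma gauss_floor_gt0 : 0 < gauss_floor.
Proof.
by rewrite divr_gt0// mulr_gt0 ?expR_gt0// normal_peak_gt0// oner_neq0.
Qed.

Lemma normal_periodic_lower_bound k (l s : R) : continuous k ->
  (forall x, 0 <= k x) -> (forall x, k (x + 1) = k x) -> unit_mean k = 1 ->
  0 < l -> l <= s ->
  (gauss_floor%:E <= \int[normal_prob 0 s]_x (k (x / l))%:E)%E.
Proof.
move=> ck k0 k1 mk l0 ls; have s0 := lt_le_trans l0 ls.
have sn0 : s != 0 by rewrite gt_eqF.
have ckl : continuous (fun x : R => k (x / l)).
  move=> x; apply: (@continuous_comp _ _ _ (fun x : R => x / l) k); last exact: ck.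
  by apply: cvgMl; exact: cvg_id.
rewrite ge0_integral_normal_prob; last 2 first.
- by apply/measurable_EFinP; exact: continuous_measurable_fun.
- by move=> x; rewrite lee_fin.
(* Here s is the standard deviation: n whole periods fit in [0, s], and n >= 1 gives s <= 2 n l. *)
pose n := Num.truncn (s / l).
have sl1 : 1 <= s / l by rewrite ler_pdivlMr// mul1r.
have /andP[nsl sln] : n%:R <= s / l < n.+1%:R.
  by apply: truncn_itv; rewrite (le_trans _ sl1).
have nl : n%:R * l <= s by rewrite -ler_pdivlMr.
have n1 : 1 <= n%:R :> R.
  rewrite ler1n lt0n; apply/eqP => n0; move: sln; rewrite n0; lra.
have nl2 : s <= 2 * (n%:R * l).
  by rewrite mulrA -ler_pdivrMr//; move: sln; rewrite -natr1; lra.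
have nl0 : 0 <= n%:R * l by rewrite mulr_ge0// ltW.
set w := normal_peak s * expR (- 2^-1).
have w0 : 0 <= w by rewrite mulr_ge0 ?expR_ge0 ?normal_peak_ge0.
have [A dA] := primitive_exists ck.
have dAl (x : R) : is_derive x 1 (fun x => l * A (x / l)) (k (x / l)).
  have dAx : is_derive (l^-1 * x) 1 A (k (l^-1 * x)) by [].
  have dl : is_derive x 1 (l^-1 \*: (id : R -> R)) l^-1.
    by apply: is_derive_eq; rewrite /GRing.scale/= mulr1.
  rewrite (_ : (fun x => _) = l \*: (A \o (l^-1 \*: (id : R -> R)))); last first.
    by apply/funext => y /=; rewrite /GRing.scale/= (mulrC y).
  apply: is_derive_eq; rewrite /GRing.scale/= (mulrC x).
  by field; rewrite gt_eqF.
have I1 : \int[lebesgue_measure]_(x in `[0, n%:R * l]) k (x / l) = n%:R * l.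
  rewrite (Rintegral_primitive ckl dAl)// mulfK ?gt_eqF// mul0r -mulrBr.
  have := primitive_periodic n 0 ck k1 dA.
  by rewrite add0r mk mulr1 => ->; rewrite mulrC.
have iE : (\int[lebesgue_measure]_(x in `[0%R, (n%:R * l)%R]) (k (x / l))%:E)%E =
    (n%:R * l)%:E.
  rewrite -[in RHS]I1 /Rintegral fineK//.
  by apply: integrable_fin_num => //; exact: (continuous_itv_integrable 0 (n%:R * l) ckl).
have -> : gauss_floor = w * (s / 2).
  rewrite /gauss_floor /w (_ : normal_peak 1 = normal_peak s * s); first by field.
  rewrite /normal_peak expr1n mul1r -mulrnAr sqrtrM ?sqr_ge0// sqrtr_sqr.
  by rewrite gtr0_norm// invfM mulrC mulrA divff// mul1r.
apply: (@le_trans _ _ (w * (n%:R * l))%:E).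
  by rewrite lee_fin ler_wpM2l//; lra.
rewrite EFinM -iE -ge0_integralZl//=; last 2 first.
- by apply/measurable_EFinP; apply: measurable_funTS; exact: continuous_measurable_fun.
- by move=> x _; rewrite lee_fin.
have mkl : measurable_fun setT (fun x : measurableTypeR R => (k (x / l))%:E).
  by apply/measurable_EFinP; exact: continuous_measurable_fun.
have mkp : measurable_fun setT (fun x : measurableTypeR R =>
    ((k (x / l))%:E * (normal_pdf 0 s x)%:E)%E).
  by apply: emeasurable_funM => //; apply/measurable_EFinP; exact: measurable_normal_pdf.
apply: (@le_trans _ _ (\int[lebesgue_measure]_(x in `[0%R, (n%:R * l)%R])
    ((k (x / l))%:E * (normal_pdf 0 s x)%:E))%E); last first.
  apply: ge0_subset_integral => // x _.
  by rewrite mule_ge0// lee_fin// normal_pdf_ge0.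
apply: ge0_le_integral => //.
- by move=> x _; rewrite mule_ge0// lee_fin.
- by apply: emeasurable_funM => //; exact: measurable_funTS.
- by apply: measurable_funTS.
- move=> x; rewrite /= in_itv/= => /andP[x0 xnl].
  rewrite muleC lee_wpmul2l ?lee_fin// normal_pdf0E// ler_wpM2l ?normal_peak_ge0//.
  rewrite ler_expR lerN2 -mulr_natr invfM mulrA ler_piMl// ler_pdivrMr ?mul1r ?exprn_gt0//.
  have xs : x <= s := le_trans xnl nl.
  by rewrite ler_pXn2r// nnegrE ltW.
Qed.

End Periodic.

(** * The multiscale profile *)

Section ShearDivergence.
Variable R : realType.
Implicit Types (F f : R -> R) (x : 'rV[R]_2).

Let derive_const_along (G : 'rV[R]_2 -> R) x (v : 'rV[R]_2) :
  (forall e, G (e *: v + x) = G x) -> 'D_v G x = 0.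
Proof.
move=> Gv; rewrite /derive (_ : (fun e => _) = fun=> 0).
  by apply: cvg_lim => //; exact: cvg_cst.
by apply/funext => e; rewrite /= Gv subrr scaler0.
Qed.

Lemma shear_drift0 F x : (- mx_divergence (shear_stream F) x) 0 0 = 0.
Proof.
rewrite !mxE big_ord_recl big_ord1.
rewrite !derive_const_along ?addr0 ?oppr0// => e; rewrite !mxE/=.
- by rewrite mulr0 add0r.
- by rewrite subrr !mulr0.
Qed.

(** The second row of the matrix is (- F(x_1), 0), so minus its divergence is F'(x_1). *)
Lemma shear_drift1 F f x : (forall z : R, is_derive z 1 F (f z)) ->
  (- mx_divergence (shear_stream F) x) 0 1 = f (x 0 0).
Proof.
move=> dF; rewrite !mxE big_ord_recl big_ord1.
rewrite [X in - (_ + X)]derive_const_along; last first.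
  by move=> e; rewrite !mxE/= subrr !mulr0.
rewrite addr0 (_ : 'D_ _ _ _ = 'D_1 (- F) (x 0 0)).
  by rewrite deriveN// derive_val opprK.
rewrite /derive [X in lim (X @ _)](_ : _ =
  fun e : R => e^-1 *: ((- F) (e *: 1 + x 0 0) - (- F) (x 0 0)))//.
apply/funext => e /=; congr (_ *: _).
by rewrite !mxE/= !sub0r !mulrN1.
Qed.

End ShearDivergence.

(** * The self-similar profile and its splitting at a scale *)

Section MultiscaleProfile.
Variables (R : realType) (r : nat -> int) (gamma : nat -> R) (h : nat -> R -> R).
Variables (rho gam K0 K2 : R).
Hypotheses (data : multiscale_data r gamma h)
  (rho_minE : rho_min R r = rho%:E) (rho_maxE : rho_max R r = rho%:E)
  (gamma_minE : gamma_min gamma = gam%:E) (gamma_maxE : gamma_max gamma = gam%:E)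
  (h1_0 : forall n, (h n)^`()%classic 0 = 0)
  (K0E : max_oscillation h = K0%:E) (K2E : max_deriv_norm 2 h = K2%:E).

Lemma rho_ge2 : 2 <= rho.
Proof. by have := rho_min_ge2 data; rewrite rho_minE lee_fin. Qed.

Lemma rE n : (0 < n)%N -> (r n)%:~R = rho.
Proof.
move=> n0; apply/eqP; rewrite eq_le -!lee_fin.
by rewrite -{1}rho_maxE -{1}rho_minE ereal_sup_ubound ?ereal_inf_lbound//; exists n.
Qed.

Lemma scaleE n : scale R r n = rho ^+ n.
Proof.
rewrite /scale rmorph_prod big_ord_recl/= (r_0 data) mul1r.
by under eq_bigr do rewrite rE//; rewrite prodr_const card_ord.
Qed.

Lemma gam_gt1 : 1 < gam.
Proof. by have := gamma_min_gt1 data; rewrite gamma_minE lte_fin. Qed.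

Lemma gammaE n : gamma n = gam ^+ n.
Proof.
have ratio k : gamma k.+1 / gamma k = gam.
  apply/eqP; rewrite eq_le -!lee_fin.
  by rewrite -{1}gamma_maxE -{1}gamma_minE ereal_sup_ubound ?ereal_inf_lbound//; exists k.
elim: n => [|n ih]; first by rewrite (gamma_0 data) expr0.
have g0 : gamma n != 0.
  by rewrite ih expf_neq0// gt_eqF// (lt_trans ltr01 gam_gt1).
by rewrite -(divfK g0 (gamma n.+1)) ratio ih exprS.
Qed.

Lemma h_osc n x y : `|h n x - h n y| <= K0.
Proof.
wlog : x y / 0 <= h n x - h n y.
  move=> wl; have [xy|/ltW xy] := leP 0 (h n x - h n y); first exact: wl.
  by rewrite distrC; apply: wl; rewrite -opprB oppr_ge0.
move=> xy; rewrite ger0_norm// -lee_fin -K0E.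
apply: (@le_trans _ _ (oscillation (h n))).
  by rewrite EFinB; apply: leeB; [apply: ereal_sup_ubound|apply: ereal_inf_lbound]; eexists.
by apply: ereal_sup_ubound; exists n.
Qed.

Lemma K0_ge0 : 0 <= K0.
Proof. exact: le_trans (h_osc 0 0 0). Qed.

Lemma h_le n x : `|h n x| <= K0.
Proof. by have := h_osc n x 0; rewrite (h_at_0 data) subr0. Qed.

Let h1 n := derive1n 1 (h n).
Let h2 n := derive1n 2 (h n).

Lemma is_derive_h n (x : R) : is_derive x 1 (h n) (h1 n x).
Proof.
have := @h_smooth _ _ _ _ data n 0%N x => /= dh.
by rewrite /h1/= derive1E; exact: derivableP.
Qed.

Lemma is_derive_h1 n (x : R) : is_derive x 1 (h1 n) (h2 n x).
Proof.
have := @h_smooth _ _ _ _ data n 1%N x => /= dh.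
by rewrite /h2/= derive1E; exact: derivableP.
Qed.

Let deriv_norm_ge k n x : (`|derive1n k (h n) x|%:E <= max_deriv_norm k h)%E.
Proof.
apply: (@le_trans _ _ (sup_norm (derive1n k (h n)))).
  by apply: ereal_sup_ubound; exists x.
by apply: ereal_sup_ubound; exists n.
Qed.

Lemma h2_le n x : `|h2 n x| <= K2.
Proof. by rewrite -lee_fin -K2E; exact: deriv_norm_ge. Qed.

Lemma K2_ge0 : 0 <= K2.
Proof. exact: le_trans (h2_le 0 0). Qed.

(** The bound is existential because it feeds only discretization errors. *)
Lemma h1_bounded : exists K1, forall n x, `|h1 n x| <= K1.
Proof.
have := h_deriv_fin data; have := deriv_norm_ge 1.
case: (max_deriv_norm 1 h) => [K1| |] H // _.
  by exists K1 => n x; rewrite -lee_fin; exact: H.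
by have := H 0%N 0.
Qed.

Lemma continuous_h n : continuous (h n).
Proof. by move=> x; exact: is_derive_continuous (is_derive_h n x). Qed.

(** The ratio of the second derivatives of consecutive scales. First derivatives scale by gam / rho,
    which exceeds 1 for alpha > 1; q < 1 expresses alpha < 2. *)
Let q := gam / rho ^+ 2.
Let u k x := gam ^+ k * h k (x / rho ^+ k).
Let du k x := (gam / rho) ^+ k * h1 k (x / rho ^+ k).
Let d2u k x := q ^+ k * h2 k (x / rho ^+ k).

Let rho_gt0 : 0 < rho.
Proof. exact: lt_le_trans rho_ge2. Qed.

Let gam_gt0 : 0 < gam.
Proof. exact: lt_trans gam_gt1. Qed.

Let q_gt0 : 0 < q.
Proof. by rewrite divr_gt0 ?exprn_gt0. Qed.

Lemma is_derive_rescaled (F dF : R -> R) (c l x : R) :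
  (forall z : R, is_derive z 1 F (dF z)) ->
  is_derive x 1 (fun z => c * F (z / l)) (c / l * dF (x / l)).
Proof.
move=> dFP; have dFx : is_derive (l^-1 * x) 1 F (dF (l^-1 * x)) by [].
have dl : is_derive x 1 (l^-1 \*: (id : R -> R)) l^-1.
  by apply: is_derive_eq; rewrite /GRing.scale/= mulr1.
rewrite (_ : (fun x => _) = c \*: (F \o (l^-1 \*: (id : R -> R)))); last first.
  by apply/funext => y /=; rewrite /GRing.scale/= (mulrC y).
by apply: is_derive_eq; rewrite /GRing.scale/= (mulrC x); ring.
Qed.

Let dU k (x : R) : is_derive x 1 (u k) (du k x).
Proof.
rewrite /du expr_div_n; exact: is_derive_rescaled (is_derive_h k).
Qed.

Let d2U k (x : R) : is_derive x 1 (du k) (d2u k x).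
Proof.
rewrite /d2u (_ : q ^+ k = (gam / rho) ^+ k / rho ^+ k).
  exact: is_derive_rescaled (is_derive_h1 k).
by rewrite /q -expr_div_n; congr (_ ^+ _); field; rewrite gt_eqF.
Qed.

Let duK k x y : `|du k y - du k x| <= K2 * q ^+ k * `|y - x|.
Proof.
apply: lipschitz_of_derive (d2U k) _ => z.
have qk : 0 <= q ^+ k by rewrite exprn_ge0// ltW.
by rewrite /d2u normrM (ger0_norm qk) mulrC ler_wpM2r// h2_le.
Qed.

Let u0 k : u k 0 = 0.
Proof. by rewrite /u mul0r (h_at_0 data) mulr0. Qed.

Let du0 k : du k 0 = 0.
Proof. by rewrite /du mul0r /h1/= h1_0 mulr0. Qed.

Let f x := limn (series (du^~ x)).

Hypothesis q_lt1 : q < 1.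

Let q01 : 0 < q < 1. Proof. by rewrite q_gt0. Qed.

Lemma shear_profile_derive (x : R) : is_derive x 1 (shear_profile r gamma h) (f x).
Proof.
have := termwise_derive q01 dU duK u0 du0 x; rewrite -/(f x).
congr (is_derive _ _ _ _); apply/funext => y; rewrite /shear_profile.
congr (limn (series _)); apply/funext => k.
by rewrite /u scaleE gammaE.
Qed.

Let low n x := \sum_(k < n) u k x.
Let dlow n x := \sum_(k < n) du k x.
Let tail n x := f x - dlow n x.

Lemma tail_lipschitz n x y :
  `|tail n y - tail n x| <= K2 * q ^+ n / (1 - q) * `|y - x|.
Proof. exact: (termwise_lipschitz_tail q01 duK du0). Qed.

Lemma f_lipschitz x y : `|f y - f x| <= K2 / (1 - q) * `|y - x|.
Proof.
have E z : tail 0 z = f z by rewrite /tail (_ : dlow 0 z = 0) ?subr0// /dlow big_ord0.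
by rewrite -!E -[K2]mulr1 -(expr0 q); exact: tail_lipschitz.
Qed.

Lemma tail_at_0 n : tail n 0 = 0.
Proof.
have -> : tail n 0 = f 0.
  by rewrite /tail /dlow big1 ?subr0// => k _; exact: du0.
(* All terms vanish at 0, so the tail estimate applies with constant K = 0. *)
have := geometric_dominated_tail (a := du^~ 0) (K := 0) 0 q01.
rewrite big_ord0 subr0 !mul0r => H; apply/eqP; rewrite -normr_le0 -/(f 0).
by apply: H => k; rewrite du0 normr0 mul0r.
Qed.

Lemma is_derive_low n (x : R) : is_derive x 1 (low n) (dlow n x).
Proof.
rewrite (_ : low n = \sum_(k < n) u k); first exact: is_derive_sum.
by apply/funext => y; rewrite fct_sumE.
Qed.

(** A geometric sum dominated by its last term: relative to gam^n, the lower scales carry the factor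
    1 / (gam - 1), small for large gam. *)
Lemma low_le n x : `|low n x| <= K0 * gam ^+ n / (gam - 1).
Proof.
have gam1 : 0 < gam - 1 by rewrite subr_gt0 gam_gt1.
rewrite (le_trans (ler_norm_sum _ _ _))//.
apply: (@le_trans _ _ (\sum_(k < n) gam ^+ k * K0)).
  apply: ler_sum => k _; have gk : 0 <= gam ^+ k by rewrite exprn_ge0// ltW.
  by rewrite /u normrM (ger0_norm gk) ler_wpM2l// h_le.
rewrite -mulr_suml ler_pdivlMr// mulrC mulrA -subrX1 mulrC ler_wpM2l ?K0_ge0//.
by rewrite gerBl.
Qed.

Lemma dlow_bounded n : exists A, forall x, `|dlow n x| <= A.
Proof.
have [K1 hK1] := h1_bounded.
exists (\sum_(k < n) (gam / rho) ^+ k * K1) => x.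
rewrite (le_trans (ler_norm_sum _ _ _))//; apply: ler_sum => k _.
have g0 : 0 <= (gam / rho) ^+ k by rewrite exprn_ge0// divr_ge0// ltW.
by rewrite /du normrM (ger0_norm g0) ler_wpM2l.
Qed.

Lemma dlow_lipschitz n x y :
  `|dlow n y - dlow n x| <= (\sum_(k < n) K2 * q ^+ k) * `|y - x|.
Proof.
rewrite /dlow -sumrB (le_trans (ler_norm_sum _ _ _))// mulr_suml.
exact: ler_sum.
Qed.

(** * Displacement bounds at an arbitrary scale *)

Section Displacement.
Context d (T : measurableType d) (P : probability T R).
Variables (omega y : R -> T -> 'rV[R]_2).
Hypotheses (bm : brownian_motion P omega)
  (sol : sde_solution P omega
    (fun x => - mx_divergence (shear_stream (shear_profile r gamma h)) x) y).

Let Y t w := y t w 0 1.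

Let measurable_Y t : 0 <= t -> measurable_fun setT (Y t).
Proof. by move=> t0; exact: (sde_process sol). Qed.

(** The drift has no first component, so the first coordinate of y is B and the unknown disappears
    from the integral. *)
Let Y_eq : {ae P, forall w, forall t, 0 <= t -> Y t w = motion omega 1 t w +
  \int[lebesgue_measure]_(s in `[0, t]) f (motion omega 0 s w)}.
Proof.
apply: filterS2 (bm_start bm) (sde_equation sol) => w w0 yw t t0.
have {}w0 i : omega 0 w 0 i = 0 by move: w0 => /= ->; rewrite mxE.
rewrite /Y (yw t t0) !mxE /motion w0 subr0; congr (_ + _).
apply: eq_Rintegral => s; rewrite inE/= in_itv/= => /andP[s0 _].
rewrite (shear_drift1 _ shear_profile_derive) w0 subr0 (yw s s0) !mxE.
under eq_Rintegral do rewrite shear_drift0.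
by rewrite /Rintegral integral0 addr0.
Qed.

Section Scale.
Variable n : nat.

Let l := rho ^+ n.
Let Gam := gam ^+ n.
Let Kg := K0 * gam ^+ n / (gam - 1).
Let e := K2 * q ^+ n.+1 / (1 - q).
Let k x := h n x - unit_mean (h n).
Let phi x := k (x / l).
(** The additive constant is chosen to centre scale n: its primitive is then periodic, and the mean
    of phi^2 over a period is the variance 1. For the lower scales [low_le] suffices without
    centring. *)
Let g x := low n x + Gam * phi x.

Let l_gt0 : 0 < l. Proof. by rewrite exprn_gt0. Qed.
Let Gam_gt0 : 0 < Gam. Proof. by rewrite exprn_gt0. Qed.

Let continuous_k : continuous k.
Proof. by move=> x; apply: cvgB; [exact: continuous_h|exact: cvg_cst]. Qed.

Let k_periodic x : k (x + 1) = k x.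
Proof. by rewrite /k (h_periodic data). Qed.

Let k_le x : `|k x| <= K0.
Proof. by apply: unit_mean_near; [exact: continuous_h|exact: h_osc]. Qed.

Let k_mean : unit_mean k = 0.
Proof.
have [A dA] := primitive_exists (@continuous_h n).
have dK (x : R) : is_derive x 1 (A - unit_mean (h n) \*: id) (k x).
  by apply: is_derive_eq; rewrite /GRing.scale/= mulr1.
rewrite {1}/unit_mean (Rintegral_primitive continuous_k dK)//=.
rewrite /unit_mean (Rintegral_primitive (@continuous_h n) dA)//.
rewrite -[LHS]/(A 1 - (A 1 - A 0) * 1 - (A 0 - (A 1 - A 0) * 0)); ring.
Qed.

Let dg_is_derive (x : R) : is_derive x 1 g (dlow n.+1 x).
Proof.
rewrite /dlow big_ord_recr/= -/(dlow n x).
have := dU n x; have := is_derive_low n x => d1 d2.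
rewrite (_ : g = low n + u n - cst (Gam * unit_mean (h n))).
  by apply: is_derive_eq; rewrite subr0.
apply/funext => z.
rewrite -[RHS]/(low n z + Gam * h n (z / l) - Gam * unit_mean (h n)) /g /phi /k.
ring.
Qed.

Let g_le x : `|g x| <= Kg + Gam * K0.
Proof.
rewrite (le_trans (ler_normD _ _))// lerD ?low_le//.
by rewrite normrM (gtr0_norm Gam_gt0) ler_wpM2l ?k_le// ltW.
Qed.

Let continuous_low : continuous (low n).
Proof. by move=> x; exact: is_derive_continuous (is_derive_low n x). Qed.

(** The primitive of the centred scale n is bounded, with oscillation of order Gam l K0 however far
    B travels; only the lower scales contribute a Lipschitz part. *)
Let primitive_g : exists G, (forall x : R, is_derive x 1 G (2 * g x)) /\
  forall x z, `|G z - G x| <= 2 * Gam * l * K0 + 2 * Kg * `|z - x|.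
Proof.
have [P0 dP0] := primitive_exists continuous_low.
have [H dH] := primitive_exists continuous_k.
exists (2 \*: (P0 + (fun x => (Gam * l) * H (x / l)))); split.
  move=> x; have dHl := is_derive_rescaled (Gam * l) l x dH.
  apply: is_derive_eq; rewrite /GRing.scale/= /g /phi.
  by rewrite mulfK// gt_eqF.
move=> x z; rewrite /GRing.scale/=.
have -> : 2 * (P0 z + Gam * l * H (z / l)) - 2 * (P0 x + Gam * l * H (x / l)) =
    2 * Gam * l * (H (z / l) - H (x / l)) + 2 * (P0 z - P0 x) by ring.
rewrite (le_trans (ler_normD _ _))// lerD//.
  have c0 : 0 <= 2 * Gam * l by rewrite !mulr_ge0// ltW.
  rewrite normrM (ger0_norm c0) ler_wpM2l//.
  exact: primitive_zero_mean_bounded continuous_k k_periodic dH k_mean k_le.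
rewrite normrM normr_nat -mulrA ler_wpM2l//.
exact: (lipschitz_of_derive x z dP0 (low_le n)).
Qed.

(** k^2 is periodic with mean 1, and s >= l^2 makes the deviation of B_s at least one period l. This
    is why the window must start after l^2. *)
Let phi_lower_bound s : l ^+ 2 <= s ->
  gauss_floor R <= \int[P]_w (phi (motion omega 0 s w) ^+ 2).
Proof.
move=> ls; have s0 : 0 < s by apply: lt_le_trans ls; rewrite exprn_gt0.
have ck2 : continuous (fun x => k x ^+ 2).
  move=> x; apply: (@continuous_comp _ _ _ k (fun x => x ^+ 2)).
    exact: continuous_k.
  exact: exprn_continuous.
have mphi2 : measurable_fun setT (fun x => (phi x ^+ 2)%:E).
  apply/measurable_EFinP; apply: measurable_funX.
  apply: (measurableT_comp (f := k)); first exact: continuous_measurable_fun.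
  exact: measurable_funM.
have ls' : l <= Num.sqrt s.
  by rewrite -(ger0_norm (ltW l_gt0)) -sqrtr_sqr ler_sqrt// ltW.
have := normal_periodic_lower_bound ck2 (fun x => sqr_ge0 _)
  (fun x => congr1 (fun z => z ^+ 2) (k_periodic x)) (h_variance data n) l_gt0 ls'.
rewrite -{1}(subr0 s) -(ge0_integral_increment bm 0 (lexx 0) s0 mphi2); last first.
  by move=> x; rewrite lee_fin sqr_ge0.
under eq_integral do rewrite motion0 subr0.
rewrite -lee_fin /Rintegral fineK//.
apply: integrable_fin_num => //.
apply: (@square_integrable_bounded _ _ _ P K0 _ _ _).2; last first.
  by move=> w; exact: k_le.
apply: (measurableT_comp (f := phi)); last exact: (measurable_motion bm 0 (ltW s0)).
apply: (measurableT_comp (f := k)); first exact: continuous_measurable_fun.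
exact: measurable_funM.
Qed.

(** Valid for every n; matching n and the window to t is left to the choice of the constants. *)
Lemma displacement_bounds (t : R) : 0 <= t -> square_integrable P (Y t) /\
  second_moment P (Y t) <=
    2 * t + 256 * (Kg + Gam * K0) ^+ 2 * t + 16 * e ^+ 2 * t ^+ 3 /\
  forall a, l ^+ 2 <= a -> a <= t ->
    2 * Gam ^+ 2 * (gauss_floor R * (t - a)) - (4 * e ^+ 2 * (t - a) ^+ 3 +
      16 * (2 * Gam * l * K0) ^+ 2 + 96 * Kg ^+ 2 * (t - a)) <=
    second_moment P (Y t).
Proof.
move=> t0; have [G [dG GK]] := primitive_g.
have [A1 hA1] := dlow_bounded n.+1.
have fE z : f z = dlow n.+1 z + tail n.+1 z by rewrite /tail addrC subrK.
have [sY mYt] := displacement_upper_bound bm f_lipschitz measurable_Y Y_eq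
  dG dg_is_derive g_le hA1 (dlow_lipschitz n.+1) (tail_lipschitz n.+1) fE
  (tail_at_0 n.+1) t0.
split => //; split => // a la at_.
have a0 : 0 <= a by apply: le_trans la; exact: sqr_ge0.
apply: (displacement_lower_bound bm f_lipschitz measurable_Y Y_eq
  dG dg_is_derive g_le hA1 (dlow_lipschitz n.+1) (tail_lipschitz n.+1) fE
  (g0 := low n) (phi := phi) (Kphi := K0) _ _ _ _ _ _ a0 at_) => //.
- exact: continuous_measurable_fun.
- apply: (measurableT_comp (f := k)); first exact: continuous_measurable_fun.
  exact: measurable_funM.
- exact: low_le.
- by move=> z; exact: k_le.
- by move=> s as_; apply: phi_lower_bound; exact: le_trans as_.
Qed.

End Scale.
End Displacement.
End MultiscaleProfile.

(** * Choice of the constants *)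

Section Constants.
Variable R : realType.

Local Notation c0 := (gauss_floor R).

(* The observation window has length window K0 * rho ^ (2 n). *)
Definition window (K0 : R) : R := 64 * K0 ^+ 2 / c0 + 1.

(** Threshold for gam = rho^alpha. The summand 2 ensures gam - 1 >= 1, so that a linear threshold
    also bounds (gam - 1)^2. *)
Definition low_separation (K0 : R) : R := 384 * K0 ^+ 2 / c0 + 2.

(** Threshold for 1 / q = rho^(2 - alpha), with q = gam / rho^2. The summand 2 gives q <= 1 / 2,
    hence 1 / (1 - q) <= 2; its square turns 16 into 64. *)
Definition high_separation (K0 K2 : R) : R := 64 * window K0 ^+ 2 * K2 ^+ 2 / c0 + 2.

(** The Lipschitz constant of the slow part at scale n, in units of gam^n / rho^(2 n). *)
Definition high_ratio (K2 rho gam : R) : R :=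
  K2 * (gam / rho ^+ 2) / (1 - gam / rho ^+ 2).

Lemma window_ge1 K0 : 1 <= window K0.
Proof.
have c0_ge0 := ltW (gauss_floor_gt0 R).
by rewrite /window lerDr divr_ge0// mulr_ge0 ?sqr_ge0.
Qed.

Lemma low_separation_ge2 K0 : 2 <= low_separation K0.
Proof.
have c0_ge0 := ltW (gauss_floor_gt0 R).
rewrite /low_separation lerDr; apply: divr_ge0 c0_ge0.
by apply: mulr_ge0; [exact: ler0n|exact: sqr_ge0].
Qed.

Lemma high_separation_ge2 K0 K2 : 2 <= high_separation K0 K2.
Proof.
have c0_ge0 := ltW (gauss_floor_gt0 R).
by rewrite /high_separation lerDr divr_ge0// mulr_ge0 ?sqr_ge0// mulr_ge0 ?sqr_ge0.
Qed.

(** The least n satisfying the second inequality; one exists since rho^n >= n. *)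
Lemma scale_exists (C rho t : R) : 2 <= rho -> 0 < C -> C <= t ->
  exists n : nat, C * (rho ^+ n) ^+ 2 <= t /\ t < C * (rho ^+ n.+1) ^+ 2.
Proof.
move=> rho2 C0 Ct.
have pow_ge n : n%:R <= rho ^+ n.
  elim: n => [|n ih]; first by rewrite expr0.
  rewrite exprS -natr1; have rn1 : 1 <= rho ^+ n by rewrite exprn_ege1//; lra.
  by nra.
have ex : exists n, t < C * (rho ^+ n.+1) ^+ 2.
  exists (Num.truncn (t / C)); rewrite -ltr_pdivrMl// mulrC.
  set m := Num.truncn _; rewrite (lt_le_trans (truncnS_gt _))// -/m.
  rewrite (le_trans (pow_ge m.+1))// expr2 ler_peMl ?exprn_ge0//; first lra.
  by rewrite exprn_ege1//; lra.
have := ex_minnP ex => -[n tn min]; exists n; split => //.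
(* For n = 0 the first inequality is C <= t; for a successor it is minimality. *)
case: n tn min => [|n] _ min; first by rewrite expr0 expr1n mulr1.
by rewrite leNgt; apply/negP => /min; rewrite ltnn.
Qed.

Lemma powR_scale (rho gam alpha : R) (n : nat) : 0 < rho -> gam = rho `^ alpha ->
  ((rho ^+ n) ^+ 2) `^ alpha = (gam ^+ n) ^+ 2.
Proof.
move=> rho0 ->; rewrite -!exprM.
rewrite -(powR_mulrn _ (ltW rho0)) -(powR_mulrn _ (powR_ge0 rho alpha)).
by rewrite -!powRrM mulrC.
Qed.

Lemma separation_low (rho gam alpha K0 : R) : 0 < alpha -> 0 < rho ->
  gam = rho `^ alpha -> low_separation K0 `^ alpha^-1 <= rho ->
  384 * K0 ^+ 2 <= c0 * (gam - 1) ^+ 2.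
Proof.
move=> al0 rho0 gamE le.
have S2 := low_separation_ge2 K0.
have Sg : low_separation K0 <= gam.
  have -> : low_separation K0 = (low_separation K0 `^ alpha^-1) `^ alpha.
    by rewrite -powRrM mulVf ?gt_eqF// powRr1//; lra.
  by rewrite gamE ge0_ler_powR// ?nnegrE ?powR_ge0// ltW.
have c0_gt0 := gauss_floor_gt0 R.
have E : 384 * K0 ^+ 2 = c0 * (low_separation K0 - 2).
  by rewrite /low_separation addrK [RHS]mulrCA divff ?mulr1// gt_eqF.
rewrite E ler_wpM2l ?ltW//; nra.
Qed.

(** Since rho^(2 - alpha) gam = rho^2, the assumption on rho says that q = gam / rho^2 is at most
    the inverse of the threshold. *)
Lemma separation_high (rho gam alpha K0 K2 : R) : alpha < 2 -> 0 < rho -> 0 < gam -> 0 <= K2 ->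
  gam = rho `^ alpha -> high_separation K0 K2 `^ (2 - alpha)^-1 <= rho ->
  gam / rho ^+ 2 < 1 /\
  16 * window K0 ^+ 2 * high_ratio K2 rho gam ^+ 2 <= c0.
Proof.
move=> al2 rho0 gam0 K20 gamE le.
have S2 := high_separation_ge2 K0 K2.
have c0_gt0 := gauss_floor_gt0 R.
have a2 : 0 < 2 - alpha by rewrite subr_gt0.
have Sq : high_separation K0 K2 <= rho `^ (2 - alpha).
  have -> : high_separation K0 K2 =
      (high_separation K0 K2 `^ (2 - alpha)^-1) `^ (2 - alpha).
    by rewrite -powRrM mulVf ?gt_eqF// powRr1//; lra.
  by rewrite ge0_ler_powR// ?nnegrE ?powR_ge0// ltW.
have pE : rho `^ (2 - alpha) * gam = rho ^+ 2.
  rewrite gamE -powRD; last by rewrite (gt_eqF rho0) implybT.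
  by rewrite subrK -[2]/(2%:R) powR_mulrn// ltW.
have rho2 : 0 < rho ^+ 2 by rewrite exprn_gt0.
rewrite /high_ratio; set q := gam / rho ^+ 2.
have q0 : 0 < q by rewrite divr_gt0.
have Vq : high_separation K0 K2 * q <= 1.
  by rewrite /q mulrA ler_pdivrMr// mul1r -pE ler_wpM2r// ltW.
have E : 64 * window K0 ^+ 2 * K2 ^+ 2 = c0 * (high_separation K0 K2 - 2).
  by rewrite /high_separation addrK [RHS]mulrCA divff ?mulr1// gt_eqF.
set V := high_separation K0 K2 in S2 Sq Vq E *.
have q2 : q <= 2^-1 by nra.
split; first lra.
have kap : (K2 * q / (1 - q)) ^+ 2 <= 4 * K2 ^+ 2 * q ^+ 2.
  have -> : 4 * K2 ^+ 2 * q ^+ 2 = (2 * K2 * q) ^+ 2 by ring.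
  have q1 : 0 < 1 - q by lra.
  have KQ : 0 <= K2 * q by rewrite mulr_ge0// ltW.
  have a1 : 0 <= K2 * q / (1 - q) := divr_ge0 KQ (ltW q1).
  have a3 : 0 <= 2 * K2 * q by rewrite -mulrA; exact: mulr_ge0.
  rewrite ler_pXn2r ?nnegrE//.
  by rewrite ler_pdivrMr//; nra.
have w2 : 0 <= 16 * window K0 ^+ 2 by rewrite mulr_ge0// sqr_ge0.
apply: (@le_trans _ _ (16 * window K0 ^+ 2 * (4 * K2 ^+ 2 * q ^+ 2))).
  exact: (ler_wpM2l w2 kap).
have -> : 16 * window K0 ^+ 2 * (4 * K2 ^+ 2 * q ^+ 2) =
   64 * window K0 ^+ 2 * K2 ^+ 2 * q ^+ 2 by ring.
rewrite E -mulrA -[leRHS]mulr1 ler_wpM2l ?(ltW c0_gt0)//.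
by nra.
Qed.

(* The subtracted terms come from the higher scales, from the boundary values of
   the Ito primitive at the current scale, and from the lower scales. *)
Lemma window_balance (K0 kap gam Gam l : R) : 1 < gam -> 0 < l ->
  384 * K0 ^+ 2 <= c0 * (gam - 1) ^+ 2 ->
  16 * window K0 ^+ 2 * kap ^+ 2 <= c0 ->
  c0 * window K0 / 2 * (Gam * l) ^+ 2 <=
  2 * Gam ^+ 2 * (c0 * (window K0 * l ^+ 2)) -
  (4 * (kap * Gam / l ^+ 2) ^+ 2 * (window K0 * l ^+ 2) ^+ 3 +
   16 * (2 * Gam * l * K0) ^+ 2 +
   96 * (K0 * Gam / (gam - 1)) ^+ 2 * (window K0 * l ^+ 2)).
Proof.
move=> gam1 l0 Hlow Hhigh.
have c0_gt0 := gauss_floor_gt0 R.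
have EM : 64 * K0 ^+ 2 = c0 * (window K0 - 1).
  by rewrite /window addrK [RHS]mulrCA divff ?mulr1// gt_eqF.
have M1 := window_ge1 K0.
set M := window K0 in Hhigh EM M1 *.
have g0 : 0 < gam - 1 by rewrite subr_gt0.
pose s := K0 / (gam - 1).
have Hs : 384 * s ^+ 2 <= c0.
  by rewrite /s expr_div_n mulrA ler_pdivrMr ?exprn_gt0.
have l2 : l != 0 by rewrite gt_eqF.
have -> : 2 * Gam ^+ 2 * (c0 * (M * l ^+ 2)) -
  (4 * (kap * Gam / l ^+ 2) ^+ 2 * (M * l ^+ 2) ^+ 3 +
   16 * (2 * Gam * l * K0) ^+ 2 +
   96 * (K0 * Gam / (gam - 1)) ^+ 2 * (M * l ^+ 2)) =
   (2 * c0 * M - (4 * kap ^+ 2 * M ^+ 3 + 64 * K0 ^+ 2 + 96 * s ^+ 2 * M)) *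
   (Gam * l) ^+ 2.
  by rewrite /s; field; rewrite l2 gt_eqF.
(* Of the available 2 c0 M, the boundary term 64 K0^2 takes c0 (M - 1) by the choice of the window
   and the other two at most c0 M / 4 each, which leaves c0 M / 2 + c0. *)
rewrite ler_wpM2r ?sqr_ge0// EM.
have h1 : 4 * kap ^+ 2 * M ^+ 3 <= c0 * M / 4.
  have -> : 4 * kap ^+ 2 * M ^+ 3 = 16 * M ^+ 2 * kap ^+ 2 * (M / 4) by field.
  by rewrite -[leRHS]mulrA; apply: ler_wpM2r => //; lra.
have h2 : 96 * s ^+ 2 * M <= c0 * M / 4.
  have -> : 96 * s ^+ 2 * M = 384 * s ^+ 2 * (M / 4) by field.
  by rewrite -[leRHS]mulrA; apply: ler_wpM2r => //; lra.
nra.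
Qed.

End Constants.

Theorem theorem3p4 (R : realType) :
  exists (C0 : R -> R -> R -> R) (C1 : R -> R -> R)
         (C2 : R -> R -> R -> R -> R) (C3 : R -> R),
    (forall K0 rho : R, 0 < C1 K0 rho) /\
    (forall K0 K2 rho alpha : R, 0 < C2 K0 K2 rho alpha) /\
    forall (r : nat -> int) (gamma : nat -> R) (h : nat -> R -> R)
           (rho gam alpha K0 K2 : R),
      multiscale_data r gamma h ->
      rho_min R r = rho%:E -> rho_max R r = rho%:E ->
      gamma_min gamma = gam%:E -> gamma_max gamma = gam%:E ->
      alpha = ln gam / ln rho -> 0 < alpha < 2 ->
      Num.sqrt gam < rho ->
      (forall n, (h n)^`()%classic 0 = 0) ->
      max_oscillation h = K0%:E ->
      max_deriv_norm 2 h = K2%:E ->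
      C0 alpha K0 K2 < rho ->
    forall (d : measure_display) (T : measurableType d) (P : probability T R)
           (omega y : R -> T -> 'rV[R]_2),
      brownian_motion P omega ->
      sde_solution P omega
        (fun x => - mx_divergence (shear_stream (shear_profile r gamma h)) x)
        y ->
    forall t : R, 0 <= t -> C3 K0 <= t ->
      ((C1 K0 rho * t `^ (1 + alpha))%:E
         <= 'E_P[(fun w => (y t w 0 1) ^+ 2)%R]
         <= (C2 K0 K2 rho alpha * t `^ (1 + alpha))%:E)%E.
Proof.
pose c0 := gauss_floor R.
(* Bounds t / rho^(2 n). The summands 1 ensure E >= 1, so E^(1 + alpha) <= E^3 as alpha < 2, which
   keeps alpha out of C1. *)
pose E (K0 rho : R) := (window K0 + 1) * (1 + rho ^+ 2).
(* Both summands are nonnegative, so rho exceeds each of the two thresholds. *)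
exists (fun alpha K0 K2 => low_separation K0 `^ alpha^-1 +
  high_separation K0 K2 `^ (2 - alpha)^-1).
exists (fun K0 rho => c0 * window K0 / 2 / E K0 rho ^+ 3).
(* The noise, the scales up to n and the higher scales, each in units of gam^(2 n) t; rho^alpha is
   gam, which makes C2 a function of the permitted parameters. *)
exists (fun K0 K2 rho alpha =>
  2 + 256 * (K0 / (rho `^ alpha - 1) + K0) ^+ 2 +
  16 * (high_ratio K2 rho (rho `^ alpha) * ((window K0 + 1) * rho ^+ 2)) ^+ 2).
(* At n = 0, where l = 1, this leaves time l^2 before a window of length [window K0]. *)
exists (fun K0 => window K0 + 1).
have c0_gt0 : 0 < c0 := gauss_floor_gt0 R.
have E_ge1 K0 rho : 1 <= E K0 rho.
  have M1 := window_ge1 K0; have := sqr_ge0 rho.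
  by rewrite /E; nra.
have C1_gt0 K0 rho : 0 < c0 * window K0 / 2 / E K0 rho ^+ 3.
  have Eg : 0 < E K0 rho ^+ 3 by rewrite exprn_gt0// (lt_le_trans ltr01 (E_ge1 _ _)).
  have Mg : 0 < window K0 := lt_le_trans ltr01 (window_ge1 K0).
  exact: divr_gt0 (divr_gt0 (mulr_gt0 c0_gt0 Mg) _) Eg.
split; first exact: C1_gt0.
split.
  move=> K0 K2 rho alpha; have := sqr_ge0 (K0 / (rho `^ alpha - 1) + K0).
  set s := _ ^+ 2; move: s => s.
  have := sqr_ge0 (high_ratio K2 rho (rho `^ alpha) * ((window K0 + 1) * rho ^+ 2)).
  set s' := _ ^+ 2; move: s' => s' *; lra.
move=> r gamma h rho gam alpha K0 K2 data rmin rmax gmin gmax alphaE.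
move=> /andP[al0 al2] _ h1_0 K0E K2E C0rho d T P omega y bm sol t t0 Mt.
have rho2 := rho_ge2 data rmin.
have rho0 : 0 < rho by exact: lt_le_trans rho2.
have gam1 := gam_gt1 data gmin.
have gam0 : 0 < gam by exact: lt_trans gam1.
have K20 := K2_ge0 K2E.
have M1 := window_ge1 K0.
have gamE : gam = rho `^ alpha.
  rewrite alphaE /powR gt_eqF// divfK ?lnK ?posrE//.
  by rewrite gt_eqF// ln_gt0//; lra.
rewrite -gamE.
have S1 : low_separation K0 `^ alpha^-1 <= rho.
  by rewrite (le_trans _ (ltW C0rho))// lerDl powR_ge0.
have S2 : high_separation K0 K2 `^ (2 - alpha)^-1 <= rho.
  by rewrite (le_trans _ (ltW C0rho))// lerDr powR_ge0.
have Hlow := separation_low al0 rho0 gamE S1.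
have [q1 Hhigh] := separation_high al2 rho0 gam0 K20 gamE S2.
have M0 : 0 < window K0 + 1 by lra.
have [n [nt tn]] := scale_exists rho2 M0 Mt.
have [sY [upper lower]] := displacement_bounds data rmin rmax gmin gmax h1_0
  K0E K2E q1 bm sol n t0.
set l := rho ^+ n in nt lower; set Gam := gam ^+ n in upper lower.
have l0 : 0 < l by rewrite exprn_gt0.
have Gam0 : 0 < Gam by rewrite exprn_gt0.
have GamE : (l ^+ 2) `^ alpha = Gam ^+ 2 by exact: powR_scale.
have eE : K2 * (gam / rho ^+ 2) ^+ n.+1 / (1 - gam / rho ^+ 2) =
    high_ratio K2 rho gam * Gam / l ^+ 2.
  rewrite /high_ratio exprS expr_div_n -/Gam exprAC -/l; ring.
rewrite unlock (second_momentE sY) !lee_fin; apply/andP; split.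
- set M := window K0 in M1 M0 Mt nt tn *.
  (* The window ends at t; (M + 1) l^2 <= t leaves at least l^2 before it. *)
  pose a := t - M * l ^+ 2.
  have ta : t - a = M * l ^+ 2 by rewrite /a opprB addrC subrK.
  have la : l ^+ 2 <= a.
    by move: nt; rewrite /a mulrDl mul1r lerBrDl.
  have Ml0 : 0 <= M * l ^+ 2.
    by apply: mulr_ge0; [exact: le_trans M1|exact: sqr_ge0].
  have at_ : a <= t by rewrite -subr_ge0 ta.
  have lower_a := lower a la at_; rewrite ta eE in lower_a.
  have balance := window_balance Gam gam1 l0 Hlow Hhigh.
  apply: le_trans (le_trans balance lower_a).
  have tE : t <= E K0 rho * l ^+ 2.
    rewrite (le_trans (ltW tn))// (exprS rho n) -/l exprMn mulrA.
    apply: ler_wpM2r; first exact: sqr_ge0.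
    by apply: ler_wpM2l; [exact: ltW|rewrite lerDr].
  have E0 : 0 <= E K0 rho by exact: le_trans (E_ge1 _ _).
  have al1 : 0 <= 1 + alpha by rewrite addr_ge0// ltW.
  have t_le : t `^ (1 + alpha) <= E K0 rho ^+ 3 * (Gam * l) ^+ 2.
    apply: (@le_trans _ _ ((E K0 rho * l ^+ 2) `^ (1 + alpha))).
      by apply: ge0_ler_powR; rewrite ?nnegrE// mulr_ge0// sqr_ge0.
    have lE : (l ^+ 2) `^ (1 + alpha) = (Gam * l) ^+ 2.
      have l2 : 0 < l ^+ 2 by rewrite exprn_gt0.
      rewrite powRD; last by rewrite (gt_eqF l2) implybT.
      by rewrite (powRr1 (sqr_ge0 l)) GamE -exprMn mulrC.
    rewrite powRM ?sqr_ge0// lE.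
    apply: ler_wpM2r; first exact: sqr_ge0.
    by rewrite -powR_mulrn// ler_powR//; lra.
  have Eg : 0 < E K0 rho ^+ 3 by rewrite exprn_gt0// (lt_le_trans ltr01 (E_ge1 _ _)).
  have cM : 0 <= c0 * M / 2.
    by rewrite divr_ge0// mulr_ge0// ?(ltW c0_gt0)// (le_trans _ M1).
  rewrite -mulrA; apply: ler_wpM2l => //.
  by rewrite mulrC ler_pdivrMr// mulrC.
- set M := window K0 in M1 M0 Mt nt tn *.
  have tpos : 0 < t by apply: lt_le_trans Mt.
  have l20 : 0 < l ^+ 2 by rewrite exprn_gt0.
  have lt_ : l ^+ 2 <= t.
    apply: le_trans nt; apply: ler_peMl; [exact: ltW|lra].
  have Gt : Gam ^+ 2 <= t `^ alpha.
    by rewrite -GamE; apply: ge0_ler_powR; rewrite ?nnegrE// ltW.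
  have G1 : 1 <= Gam ^+ 2.
    by rewrite exprn_ege1// exprn_ege1// ltW.
  rewrite powRD; last by rewrite (gt_eqF tpos) implybT.
  rewrite (powRr1 t0).
  set s := K0 / (gam - 1) + K0; set kap := high_ratio K2 rho gam in eE *.
  apply: (@le_trans _ _ ((2 + 256 * s ^+ 2 +
      16 * (kap * ((M + 1) * rho ^+ 2)) ^+ 2) * (Gam ^+ 2 * t))); last first.
    apply: ler_wpM2l; last by rewrite mulrC ler_wpM2l.
    have := sqr_ge0 s; have := sqr_ge0 (kap * ((M + 1) * rho ^+ 2)); lra.
  rewrite eE in upper; apply: (le_trans upper).
  have tl : t / l ^+ 2 <= (M + 1) * rho ^+ 2.
    by rewrite ler_pdivrMr// (le_trans (ltW tn))// (exprS rho n) -/l exprMn mulrA.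
  (* Every term of the upper bound is a multiple of X, and X <= t^(1 + alpha). The noise uses Gam >=
     1, the cubic term v <= c. *)
  pose X := Gam ^+ 2 * t; pose v := t / l ^+ 2; pose c := (M + 1) * rho ^+ 2.
  have gam1' : gam - 1 != 0 by rewrite subr_eq0 gt_eqF.
  have l2' : l != 0 by rewrite gt_eqF.
  have -> : 2 * t + 256 * (K0 * Gam / (gam - 1) + Gam * K0) ^+ 2 * t +
      16 * (kap * Gam / l ^+ 2) ^+ 2 * t ^+ 3 =
      2 * t + 256 * s ^+ 2 * X + 16 * (kap ^+ 2 * v ^+ 2 * X).
    by rewrite /X /v /s; field; rewrite l2' gam1'.
  rewrite -/X -/c.
  have X0 : 0 <= X by rewrite /X mulr_ge0 ?sqr_ge0.
  have tX : t <= X by apply: ler_peMl.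
  have v0 : 0 <= v by rewrite /v divr_ge0// sqr_ge0.
  have vc : kap ^+ 2 * v ^+ 2 * X <= (kap * c) ^+ 2 * X.
    apply: ler_wpM2r => //; rewrite (exprMn _ kap c); apply: ler_wpM2l; first exact: sqr_ge0.
    by rewrite ler_pXn2r ?nnegrE// (le_trans v0).
  lra.
Qed.
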